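(* Let $(\Omega,\mu)$ be a finite measure space, let $\alpha>0$, let $\vec A=(A_0,A_1)$ be an ordered pair with $A_1$ dense in $A_0$, and for $f\in L^1(\Omega,A_0)+L^\infty(\Omega,A_1)$ let $\Psi_f(s,w)=k(s,f(w);\vec A)$, $(w,s)\in\Omega\times(0,1)$. Then $$\sum_{\theta}\frac{L^{p_\theta}(\Omega,(A_0,A_1)_{\theta,p_\theta}^{K\blacktriangleleft})}{\theta^\alpha}=\{f:\Psi_f\in L(LogL)^\alpha(\Omega\times(0,1))\},\qquad \frac{1}{p_\theta}=1-\theta .$$
   Context: A Banach pair $\vec A=(A_0,A_1)$ is ordered if $A_1\subset A_0$ with embedding of norm at most $1$. $K(t,x;\vec A)=\inf\{\Vert a_0\Vert_{A_0}+t\Vert a_1\Vert_{A_1}: x=a_0+a_1,\ a_i\in A_i\}$. When $A_0\cap A_1$ is dense in $A_0$, one has $K(t,g;\vec A)=\int_0^tk(s,g;\vec A)\,ds$ with $k(\cdot,g;\vec A)$ non-negative and decreasing; this defines $k$. For $0<\theta<1$, $1\le q<\infty$, $(A_0,A_1)_{\theta,q}^{K\blacktriangleleft}$ is the space of $x\in A_0+A_1$ with norm $(q\theta(1-\theta))^{1/q}\left(\int_0^\infty(s^{-\theta}K(s,x;\vec A))^q\frac{ds}s\right)^{1/q}<\infty$. $L^p(\Omega,B)$ denotes the Bochner space of $B$-valued functions. For a family $\{B_\theta\}_{\theta\in(0,1)}$ of Banach spaces continuously embedded, with uniformly bounded embedding norms, in a common Banach space $B$, $\sum_\theta B_\theta$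 is the space of $x\in B$ representable as $x=\sum_\theta a_\theta$, $a_\theta\in B_\theta$, with $\sum_\theta\Vert a_\theta\Vert_{B_\theta}<\infty$, with the quotient (infimum) norm. $\frac{B}{\theta^\alpha}$ denotes $B$ with its norm multiplied by $\theta^{-\alpha}$; the sum is over $\theta\in(0,1)$. $\Omega\times(0,1)$ carries the product of $\mu$ and Lebesgue measure. $L(LogL)^\alpha$ is the Zygmund space of measurable $g$ with $\int|g|(\log^+|g|)^\alpha<\infty$ and $\int|g|<\infty$. *)

(* Defs.v *)
From mathcomp Require Import all_boot all_order all_algebra.
From mathcomp Require Import all_classical all_reals all_analysis.
From mathcomp Require Import summability.

Set Implicit Arguments.
Unset Strict Implicit.
Unset Printing Implicit Defensive.

Import Order.TTheory GRing.Theory Num.Theory.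
Import numFieldNormedType.Exports.

Local Open Scope classical_set_scope.
Local Open Scope ring_scope.

(* A normed space continuously included in a vector space V is represented by
   its norm, extended by +oo outside the space: N : V -> \bar R stands for the
   space of all x with N x < +oo. Spaces of classes of functions modulo null
   sets are represented by a.e.-invariant N on functions. *)

Section normed_subspaces.
Context {R : realType} {V : zmodType}.
Implicit Types N NB : V -> \bar R.
Local Open Scope ereal_scope.

Definition pair_sum_norm N0 N1 (x : V) : \bar R :=
  ereal_inf [set N0 y + N1 (x - y)%R | y in [set: V]].

Definition scaled_norm (c : R) N (x : V) : \bar R := c%:E * N x.

(* x is the sum of the (possibly uncountable) family a in the space with norm
   NB: the net of its finite partial sums converges to x. *)
Definition is_family_sum {I : choiceType} NB (a : I -> V) (x : V) :=
  NB (x - partial_sum a F)%R @[F --> totally] --> 0%E.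

(* \sum_i B_i inside a common space B; N i is the norm of B_i, NB that of B. *)
Definition family_sum_norm {I : choiceType} NB (N : I -> V -> \bar R) (x : V) :
    \bar R :=
  ereal_inf [set \esum_(i in [set: I]) N i (a i) |
             a in [set a : I -> V | NB x < +oo /\ is_family_sum NB a x]].

End normed_subspaces.

Section ordered_pairs.
Context {R : realType} {A0 A1 : completeNormedModType R}.
Variable j : {linear A1 -> A0}.

(* The inclusion of A1 in A0 is the linear map j. *)
Definition ordered_pair := injective j /\ forall a : A1, `|j a| <= `|a|.

Definition norm0 (x : A0) : \bar R := `|x|%:E.

Definition norm1 (x : A0) : \bar R :=
  ereal_inf [set `|a|%:E | a in j @^-1` [set x]].

Definition K (t : R) (x : A0) : R :=
  inf [set r | exists a0 a1, x = a0 + j a1 /\ r = `|a0| + t * `|a1|].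

(* k s g is determined by K up to a null set of s, for each g. *)
Definition is_K_density (k : R -> A0 -> R) := forall g,
  [/\ forall s, 0 < s -> 0 <= k s g,
      forall s t, 0 < s -> s <= t -> k t g <= k s g &
      forall t, 0 < t ->
        (\int[@lebesgue_measure R]_(s in `]0%R, t[) (k s g)%:E = (K t g)%:E)%E].

(* (A0, A1)_{theta, q}^{K <|}; as a set, A0 + A1 is A0. *)
Definition interp_norm (theta q : R) (x : A0) : \bar R :=
  (((q * theta * (1 - theta)) `^ q^-1)%R%:E *
   (\int[@lebesgue_measure R]_(s in `]0%R, +oo[)
      ((s `^ (- theta) * K s x) `^ q / s)%R%:E) `^ q^-1)%E.

End ordered_pairs.

Section bochner.
Context {R : realType} {d : measure_display} {T : measurableType d}.
Variable mu : {measure set T -> \bar R}.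
Context {V : zmodType}.
Variable N : V -> \bar R.
Local Open Scope ereal_scope.

Definition simple_function (s : T -> V) :=
  [/\ finite_set (range s),
      forall v, measurable (s @^-1` [set v]) &
      forall w, N (s w) < +oo].

Definition strongly_measurable (f : T -> V) :=
  exists2 s : nat -> T -> V, (forall n, simple_function (s n)) &
    {ae mu, forall w, N (f w - s n w)%R @[n --> \oo] --> 0}.

Definition bochner_norm (p : \bar R) (f : T -> V) : \bar R :=
  if `[< strongly_measurable f >] then 'N[mu]_p[N \o f] else +oo.

End bochner.

Definition L1_Loo_norm {R : realType} {d : measure_display}
    {T : measurableType d} (mu : {measure set T -> \bar R})
    {A0 A1 : completeNormedModType R} (j : {linear A1 -> A0}) :
    (T -> A0) -> \bar R :=
  pair_sum_norm (bochner_norm mu norm0 1%E) (bochner_norm mu (norm1 j) +oo%E).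

Definition log_plus {R : realType} (x : R) : R := Num.max (ln x) 0.

(* L(LogL)^alpha on D; as usual g need only be defined and measurable up to a
   null set. *)
Definition zygmund {R : realType} {d : measure_display} {T : measurableType d}
    (m : {measure set T -> \bar R}) (D : set T) (alpha : R) (g : T -> R) :=
  exists h : T -> R,
    [/\ measurable_fun D h,
        g = h %[ae m in D],
        (\int[m]_(z in D) `|h z|%:E < +oo)%E &
        (\int[m]_(z in D) (`|h z| * log_plus `|h z| `^ alpha)%:E < +oo)%E].

Definition unit_open (R : realType) : choiceType := {theta : R | 0 < theta < 1}.

Definition p_exp {R : realType} (theta : R) : R := (1 - theta)^-1.

(* Main.v *)
(* With [1 / p = 1 - theta] the norm of [(A_0, A_1)_(theta, p)] satisfies
   [|x|^p = theta int_0^oo (K(s, x) / s)^p ds], which yields two bounds: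
   [K(r, x) <= c r + c^(1 - p) |x|^p] for all [c, r > 0], and
   [|x|^p <= A B^(p - 1)] as soon as [K(s, x) <= min(A, B s)] for all [s].

   Let [Phi_l(x) = int_0^1 (k(s, x) - l)^+ ds], that is,
   [Phi_l(x) = sup_r (K(r, x) - l r)].  Up to constants, [Psi_f] belongs to
   [L(LogL)^alpha] if and only if
   [sum_n 2^(n alpha) int Phi_(l_n)(f(w)) dmu(w)] is finite for [l_n] of the
   order of [exp(2^n)].

   If [f = sum_i a_i] with [a_i] in the space of parameter [theta_i], then the
   subadditivity of [K] and the first bound, with [c = c_i l_n] and [c_i]
   proportional to [theta_i^(-alpha) |a_i|], bound this sum, because
   [sum_n 2^(n alpha) exp(- 2^n theta)] is of the order of [theta^(-alpha)].

   Conversely, any [x] is at [A_0]-distance at most [2 Phi_l(x)], up to an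
   arbitrarily small error, from the ball of radius [2 l] of [A_1].  A
     measurable
   choice of such approximants [b_n] of [f], for [l = l_n], gives
   [f = sum_n (b_n - b_(n-1))], and by the second bound the [n]-th term fits in
   the space of parameter [theta_n = 2^(- n - 1)]. *)

(* Both bounds on the interpolation norm are equalities when K(s) = min(A, B s), so no constant
   depending on theta enters. The levels exp(2^n) make log^alpha of the n-th level equal to q^n with
   q = 2^alpha; up to a factor q this is the weight theta_n^(-alpha), while l_n^theta_n stays
   bounded. The exponent p varies with theta, and the nonlinearity is removed in two ways. For
   necessity, the share of the level given to each term is at least proportional to its norm, which
   turns |a|^p into |a|. For sufficiency, Young's inequality linearizes X^(1-theta) at the price of
   an error (2 q)^(-n), summable even against q^n. The obstacle is measurability: [k] is some
   density of K for each point separately, so k(s, f(w)) need not be jointly measurable, and f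
   itself is only almost everywhere a limit of simple functions. Hence the work with the right
   derivative of K, which is explicit, and with everywhere limits of simple maps. *)
Require Import Defs.
From mathcomp Require Import all_boot all_order all_algebra.
From mathcomp Require Import all_classical all_reals all_analysis.
From mathcomp Require Import measurable_realfun ess_sup_inf.
From mathcomp Require Import ring lra.
Set Implicit Arguments.
Unset Strict Implicit.
Unset Printing Implicit Defensive.
Import Order.TTheory GRing.Theory Num.Theory.
Import numFieldNormedType.Exports.
Local Open Scope classical_set_scope.
Local Open Scope ring_scope.

(** * The K-functional *)

Section K_functional.
Context {R : realType} {A0 A1 : completeNormedModType R}.
Variable j : {linear A1 -> A0}.
Implicit Types (s t r c : R) (x y : A0) (a : A1).

Lemma K_ge t x c : (forall a, c <= `|x - j a| + t * `|a|) -> c <= K j t x.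
Proof.
move=> h; apply: lb_le_inf.
  by exists `|x|, x, 0; rewrite linear0 addr0 normr0 mulr0 addr0.
by move=> _ [a0 [a [xE ->]]]; have := h a; rewrite xE addrK.
Qed.

Lemma K_le t x a : 0 <= t -> K j t x <= `|x - j a| + t * `|a|.
Proof.
move=> t0; apply: ge_inf; last by exists (x - j a), a; rewrite subrK.
exists 0 => _ [a0 [b [_ ->]]].
by rewrite addr_ge0 // mulr_ge0.
Qed.

Lemma K_lt t x c : K j t x < c -> exists a, `|x - j a| + t * `|a| < c.
Proof.
move=> h; apply: contrapT => /forallNP h'.
have : c <= K j t x by apply: K_ge => a; rewrite leNgt; apply/negP/h'.
by rewrite leNgt h.
Qed.

Lemma K_ge0 t x : 0 <= t -> 0 <= K j t x.
Proof. by move=> t0; apply: K_ge => a; rewrite addr_ge0 // mulr_ge0. Qed.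

Lemma K_le_norm t x : 0 <= t -> K j t x <= `|x|.
Proof.
by move=> /(K_le x 0); rewrite linear0 subr0 normr0 mulr0 addr0.
Qed.

Lemma K_image t a : 0 <= t -> K j t (j a) <= t * `|a|.
Proof. by move=> /(K_le (j a) a); rewrite subrr normr0 add0r. Qed.

(** The norm bound on [j] makes K constant from t = 1 on, which is why only s in (0, 1) matters for
    [k]. *)
Lemma K_norm t x : (forall a, `|j a| <= `|a|) -> 1 <= t -> K j t x = `|x|.
Proof.
move=> jle t1; apply/eqP; rewrite eq_le K_le_norm ?(le_trans _ t1)//=.
apply: K_ge => a; rewrite -{1}(subrK (j a) x).
rewrite (le_trans (ler_normD _ _))// lerD2l (le_trans (jle a))//.
by rewrite ler_peMl.
Qed.

Lemma K_triangle t x y : 0 <= t -> K j t (x + y) <= K j t x + K j t y.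
Proof.
move=> t0; rewrite -lerBlDr; apply: K_ge => a; rewrite lerBlDr -lerBlDl.
apply: K_ge => b; rewrite lerBlDl.
apply: le_trans (K_le (x + y) (a + b) t0) _.
rewrite linearD opprD addrACA.
have := ler_normD (x - j a) (y - j b); have := ler_normD a b.
move=> /(ler_wpM2l t0); rewrite mulrDr; lra.
Qed.

Lemma K_sum t (I : Type) (l : seq I) (F : I -> A0) : 0 <= t ->
  K j t (\sum_(i <- l) F i) <= \sum_(i <- l) K j t (F i).
Proof.
move=> t0; elim/big_ind2 : _ => //.
  by rewrite -(normr0 A0) K_le_norm.
move=> x1 x2 y1 y2 h1 h2; exact: le_trans (K_triangle _ _ t0) (lerD h1 h2).
Qed.

Lemma K_lip t x y : 0 <= t -> `|K j t x - K j t y| <= `|x - y|.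
Proof.
move=> t0; rewrite ler_norml; apply/andP; split.
  have := K_triangle x (y - x) t0; rewrite addrC subrK => h.
  have := K_le_norm (y - x) t0; rewrite distrC; lra.
have := K_triangle y (x - y) t0; rewrite addrC subrK => h.
have := K_le_norm (x - y) t0; lra.
Qed.

Lemma K_nondecreasing s t x : 0 <= s -> s <= t -> K j s x <= K j t x.
Proof.
move=> s0 st; apply: K_ge => a; apply: le_trans (K_le x a s0) _.
by rewrite lerD2l ler_wpM2r.
Qed.

(** A weak form of concavity: K(s) / s decreases while K increases. These two monotonicities give
    the lower bound on the interpolation norm. *)
Lemma K_quasiconcave s r x : 0 < s -> s <= r -> s * K j r x <= r * K j s x.
Proof.
move=> s0 sr; have r0 := lt_le_trans s0 sr.
rewrite -ler_pdivrMl//; apply: K_ge => a.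
rewrite ler_pdivrMl//; apply: le_trans (ler_wpM2l (ltW s0) (K_le x a (ltW r0)))
  _.
rewrite !mulrDr mulrCA lerD2r.
by rewrite ler_wpM2r.
Qed.

End K_functional.

(** * Best approximation by balls of A1 *)

Section approximation.
Context {R : realType} {A0 A1 : completeNormedModType R}.
Variable j : {linear A1 -> A0}.
Implicit Types (x y : A0) (a : A1).

(** The E-functional of approximation theory, that is, the distance in A0 to a ball of A1. It need
    not be attained, hence the errors [e] below. *)
Definition E_functional (L : R) x := inf [set `|x - j a| | a in [set a | `|a|
  <= L]].

Lemma E_functional_le L x a : `|a| <= L -> E_functional L x <= `|x - j a|.
Proof.
move=> aL; apply: ge_inf; last by exists a.
by exists 0 => _ [b _ <-].
Qed.

Lemma E_functional_lt L x e : 0 <= L -> 0 < e ->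
  exists a, `|a| <= L /\ `|x - j a| < E_functional L x + e.
Proof.
move=> L0 e0.
have hi : has_inf [set `|x - j a| | a in [set a | `|a| <= L]].
  split; last by exists 0 => _ [b _ <-].
  by exists `|x - j 0|, 0 => //=; rewrite normr0.
have [_ [a aL <-] h] := inf_adherent e0 hi.
by exists a.
Qed.

(** The same [a] is tried for both points. This lets an element chosen for one point serve its
    neighbours in [measurable_selection]. *)
Lemma E_functional_lip L x y : 0 <= L ->
  E_functional L x <= E_functional L y + `|x - y|.
Proof.
move=> L0; apply/ler_addgt0Pr => e e0.
have [a [aL h]] := E_functional_lt y L0 e0.
apply: le_trans (E_functional_le x aL) _.
have : `|x - j a| <= `|x - y| + `|y - j a|.
  by rewrite (le_trans _ (ler_normD _ _))// addrA subrK.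
lra.
Qed.

End approximation.

(** * The density of the K-functional *)

Section decreasing_function.
Context {R : realType}.
Notation leb := (@lebesgue_measure R).
Variable k : R -> R.
Implicit Types r s t l : R.
Hypothesis k_ge0 : forall s, 0 < s -> 0 <= k s.
Hypothesis k_ni : forall s t, 0 < s -> s <= t -> k t <= k s.

Lemma nonincreasing_pos_measurable : measurable_fun (`]0, +oo[ : set R) k.
Proof.
apply: (measurability (@RGenCInfty.G R)) => [|/= _ [_] [r] -> <-].
  exact: RGenCInfty.measurableE.
apply: is_interval_measurable => s t/=.
rewrite !in_itv/= !andbT => -[s0 ks] [t0 kt] u /andP[su ut].
have u0 := lt_le_trans s0 su.
by split; rewrite ?in_itv/= andbT ?u0// (le_trans kt)// k_ni.
Qed.

Definition excess (l : R) : \bar R :=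
  (\int[leb]_(s in `]0%R, 1%R[) (Num.max (k s - l) 0)%:E)%E.

Lemma excess_ge0 l : (0 <= excess l)%E.
Proof. by apply: integral_ge0 => s _; rewrite lee_fin le_max lexx orbT. Qed.

Let meas_pos (D : set R) : D `<=` `]0, +oo[ -> measurable_fun D k.
Proof.
by move=> h; apply: measurable_funS nonincreasing_pos_measurable.
Qed.

Lemma excess_fun_measurable (D : set R) l : D `<=` `]0, +oo[ ->
  measurable_fun D (fun s => Num.max (k s - l) 0).
Proof.
by move=> h; apply: measurable_maxr => //; apply: measurable_funB => //;
  exact: meas_pos.
Qed.

Let sub_pos r : `]0, r[ `<=` (`]0, +oo[ : set R).
Proof. by move=> s /=; rewrite !in_itv/= => /andP[->]. Qed.

Let int_cst (r l : R) : 0 < r -> 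
  (\int[leb]_(s in `]0%R, r[) (cst l%:E s) = (l * r)%:E)%E.
Proof.
by move=> r0; rewrite integral_cst//= lebesgue_measure_itv/= lte_fin r0 oppr0
  adde0.
Qed.

(** Integrate k <= (k - l)^+ + l over (0, r), then enlarge the domain of the first term to (0,
    1). *)
Lemma integral_le_excess l r : 0 <= l -> 0 < r -> r <= 1 ->
  (\int[leb]_(s in `]0%R, r[) (k s)%:E <= excess l + (l * r)%:E)%E.
Proof.
move=> l0 r0 r1.
have h1 : (\int[leb]_(s in `]0%R, r[) (k s)%:E <=
   \int[leb]_(s in `]0%R, r[) ((Num.max (k s - l) 0)%:E + cst l%:E s))%E.
  apply: ge0_le_integral => //.
  - by move=> s /=; rewrite in_itv/= => /andP[s0 _]; rewrite lee_fin k_ge0.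
  - by apply/measurable_EFinP; apply: meas_pos.
  - apply: emeasurable_funD => //; apply/measurable_EFinP.
    exact: excess_fun_measurable.
  - move=> s _ /=; rewrite -EFinD lee_fin -lerBlDr le_max lexx//.
apply: (le_trans h1); rewrite ge0_integralD//=; last 2 first.
- by move=> s _; rewrite lee_fin le_max lexx orbT.
- by apply/measurable_EFinP; exact: excess_fun_measurable.
rewrite int_cst// leeD2r//.
apply: ge0_subset_integral => //=.
- by apply/measurable_EFinP; exact: excess_fun_measurable.
- by move=> s _; rewrite lee_fin le_max lexx orbT.
- by move=> s /=; rewrite !in_itv/= => /andP[-> /lt_le_trans->].
Qed.

(* The superlevel set [k > l] is an interval [(0, r)], up to its end point, and
   there the excess integrates to [int_0^r k - l r]. *)
Lemma excess_le l (C : \bar R) : 0 <= l -> (0 <= C)%E ->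
  (forall r, 0 < r -> r <= 1 ->
    (\int[leb]_(s in `]0%R, r[) (k s)%:E <= C + (l * r)%:E)%E) ->
  (excess l <= C)%E.
Proof.
move=> l0 C0 h.
pose S := [set s | 0 < s < 1 /\ l < k s].
have [[s0 S0]|/forallNP S0] := pselect (exists s, S s); last first.
  rewrite /excess (eq_integral (cst 0%E)); first by rewrite integral0.
  move=> s; rewrite inE/= in_itv/= => s01; congr EFin; apply/max_idPr.
  by rewrite subr_le0 leNgt; apply/negP => ls; apply: (S0 s).
have Sub : has_ubound S by exists 1 => s [/andP[_ /ltW]].
have hS : has_sup S by split=> //; exists s0.
pose r := sup S.
have r0 : 0 < r.
  by have := S0 => -[/andP[s0p _] _]; rewrite (lt_le_trans s0p)//;
    exact: ub_le_sup.
have r1 : r <= 1 by apply: ge_sup; [exists s0|move=> s [/andP[_ /ltW]]].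
have ltr_S s : 0 < s -> s < r -> S s.
  move=> sp sr; have [t St st] := sup_gt hS.1 sr.
  have [/andP[t0 t1] lt] := St; split; first by rewrite sp (lt_trans st).
  by rewrite (lt_le_trans lt)// k_ni// ltW.
have S_ler s : S s -> s <= r by move=> Ss; exact: ub_le_sup.
have E : excess l = (\int[leb]_(s in `]0%R, r[) (Num.max (k s - l) 0)%:E)%E.
  have splt : `]0, 1[%classic = `]0, r[ `|` `[r, 1[ :> set R.
    by apply: itv_bndbnd_setU; rewrite bnd_simp // ltW.
  rewrite /excess splt ge0_integral_setU//=.
  - rewrite [X in (_ + X)%E](_ : _ = 0%E) ?adde0//.
    (* The point [r] itself may belong to [S]; it is dropped as a null set. *)
    rewrite -integral_itv_obnd_cbnd; last first.
      apply/measurable_EFinP; apply: excess_fun_measurable.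
      by move=> s /=; rewrite !in_itv/= => /andP[/(lt_trans r0)->].
    apply: integral0_eq => s /=; rewrite in_itv/= => /andP[rs s1].
    congr EFin; apply/max_idPr; rewrite subr_le0 leNgt; apply/negP => ls.
    have : S s by split; rewrite ?s1 ?(lt_trans r0).
    by move=> /S_ler; rewrite leNgt rs.
  - apply/measurable_EFinP; apply: excess_fun_measurable.
    rewrite -splt; exact: sub_pos.
  - by move=> s _; rewrite lee_fin le_max lexx orbT.
  - apply/disj_setPS => s /=; rewrite !in_itv/= => -[/andP[_ sr] /andP[rs _]].
    by move: rs; rewrite leNgt sr.
rewrite -(leeD2rE _ _ (_ : (l * r)%:E \is a fin_num))//.
apply: le_trans (h r r0 r1); rewrite E -int_cst// -ge0_integralD//=.
- apply: ge0_le_integral => //.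
  + by move=> s _; rewrite -EFinD lee_fin addr_ge0// le_max lexx orbT.
  + apply: emeasurable_funD => //; apply/measurable_EFinP.
    exact: excess_fun_measurable.
  + by apply/measurable_EFinP; apply: meas_pos.
  + move=> s /=; rewrite in_itv/= => /andP[s0' sr].
    rewrite -EFinD lee_fin max_l ?subrK// subr_ge0 ltW//.
    by have [] := ltr_S _ s0' sr.
- by move=> s _; rewrite lee_fin le_max lexx orbT.
- by apply/measurable_EFinP; exact: excess_fun_measurable.
Qed.

End decreasing_function.

(** * The excess of the density, and the right derivative of K *)

Section density.
Context {R : realType} {A0 A1 : completeNormedModType R}.
Notation leb := (@lebesgue_measure R).
Variable j : {linear A1 -> A0}.
Variable k : R -> A0 -> R.
Hypothesis j_le : forall a, `|j a| <= `|a|.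
Hypothesis k_dens : is_K_density j k.
Implicit Types (r s t l : R) (x : A0).

Let k_ge0 x s : 0 < s -> 0 <= k s x.
Proof. by have [h _ _] := k_dens x; exact: h. Qed.

Let k_ni x s t : 0 < s -> s <= t -> k t x <= k s x.
Proof. by have [_ h _] := k_dens x; exact: h. Qed.

Let k_int x t : 0 < t -> (\int[leb]_(s in `]0%R,
  t[) (k s x)%:E = (K j t x)%:E)%E.
Proof. by have [_ _ h] := k_dens x; exact: h. Qed.

Lemma density_measurable x (D : set R) : D `<=` `]0, +oo[ ->
  measurable_fun D (k^~ x).
Proof.
move=> h; apply: measurable_funS h _ => //.
exact: nonincreasing_pos_measurable (k_ni x).
Qed.

Definition K_excess l x : \bar R := excess (k^~ x) l.

Lemma K_le_excess l r x : 0 <= l -> 0 < r ->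
  ((K j r x)%:E <= K_excess l x + (l * r)%:E)%E.
Proof.
move=> l0 r0; have [r1|/ltW r1] := leP r 1.
  by rewrite -k_int//; apply: integral_le_excess => //;
    [exact: k_ge0|exact: k_ni].
(* K is constant beyond 1, so the bound at 1 implies all later ones. *)
rewrite K_norm// -(K_norm x j_le (lexx 1)) -k_int//.
apply: (@le_trans _ _ (K_excess l x + (l * 1)%:E)%E).
  by apply: integral_le_excess => //; [exact: k_ge0|exact: k_ni].
by rewrite leeD2l// lee_fin ler_wpM2l.
Qed.

Lemma K_excess_le l x (C : \bar R) : 0 <= l -> (0 <= C)%E ->
  (forall r, 0 < r -> ((K j r x)%:E <= C + (l * r)%:E)%E) ->
  (K_excess l x <= C)%E.
Proof.
move=> l0 C0 h; apply: excess_le => //; first exact: k_ni.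
by move=> r r0 r1; rewrite k_int//; exact: h.
Qed.

Lemma K_excess_le_norm l x : 0 <= l -> (K_excess l x <= `|x|%:E)%E.
Proof.
move=> l0; apply: K_excess_le => // r r0.
by rewrite -EFinD lee_fin (le_trans (K_le_norm j x (ltW r0)))// lerDl
  mulr_ge0// ltW.
Qed.

Lemma K_excess_fin l x : 0 <= l -> K_excess l x \is a fin_num.
Proof.
move=> l0; rewrite ge0_fin_numE ?excess_ge0//.
exact: le_lt_trans (K_excess_le_norm x l0) (ltry _).
Qed.

(** Choose [r] so that l r exceeds the excess by d / 2. Then K(r, x) < 2 l r, and a decomposition of
    cost below 2 l r has r |a| <= 2 l r, so |a| <= 2 l, and an A0-part of norm below 2 l r, which is
    twice the excess plus [d]. *)
Lemma E_functional_le_excess l x : 0 < l ->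
  ((E_functional j (2 * l) x)%:E <= 2%:E * K_excess l x)%E.
Proof.
move=> l0; have := K_excess_fin x (ltW l0).
move=> /fineK ee; rewrite -[K_excess _ _]ee -EFinM lee_fin.
have e0 : 0 <= fine (K_excess l x) by rewrite fine_ge0// excess_ge0.
apply/ler_addgt0Pr => d d0.
pose r := fine (K_excess l x) / l + d / (2 * l).
have r0 : 0 < r by rewrite ltr_wpDl ?divr_ge0 ?divr_gt0 ?mulr_gt0// ltW.
have lr : l * r = fine (K_excess l x) + d / 2.
  by rewrite /r; field; rewrite gt_eqF.
have : K j r x < 2 * (l * r).
  have := K_le_excess x (ltW l0) r0; rewrite -ee -EFinD lee_fin => h.
  by apply: (le_lt_trans h); rewrite lr; lra.
move=> /K_lt[a ha].
have aL : `|a| <= 2 * l.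
  have : r * `|a| <= 2 * (l * r) by rewrite (le_trans _ (ltW ha))// lerDr.
  by rewrite mulrA [_ * r]mulrC ler_pM2l.
apply: (@le_trans _ _ `|x - j a|); first exact: E_functional_le.
have : 0 <= r * `|a| by rewrite mulr_ge0// ltW.
move: ha; rewrite lr; lra.
Qed.

(* A version of [k] that is an explicit function of [K], hence measurable
   jointly in [s] and in a measurable parameter. *)
Definition K_rderiv s x :=
  sup (range (fun n : nat => n.+1%:R * (K j (s + n.+1%:R^-1) x - K j s x))).

Lemma K_increment s t x : 0 < s -> s < t ->
  k t x * (t - s) <= K j t x - K j s x <= k s x * (t - s).
Proof.
move=> s0 st; have t0 := lt_trans s0 st.
have splt : `]0, t[%classic = `]0, s[ `|` `[s, t[ :> set R.
  by apply: itv_bndbnd_setU; rewrite bnd_simp// ltW.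
have sub : `[s, t[ `<=` (`]0, +oo[ : set R).
  by move=> u /=; rewrite !in_itv/= => /andP[/(lt_le_trans s0)->].
have : (K j t x)%:E = ((K j s x)%:E + \int[leb]_(u in `[s, t[) (k u x)%:E)%E.
  rewrite -!k_int// splt ge0_integral_setU//=.
  - apply/measurable_EFinP; apply: density_measurable.
    by move=> u [] /=; rewrite !in_itv/= andbT => /andP[+ _] =>
      // /(lt_le_trans s0).
  - move=> u [] /=; rewrite in_itv/= => /andP[u0 _]; rewrite lee_fin k_ge0//.
    exact: lt_le_trans u0.
  - apply/disj_setPS => u /=; rewrite !in_itv/= => -[/andP[_ us] /andP[su _]].
    by move: su; rewrite leNgt us.
set I := (\int[leb]_(u in _) _)%E => E0.
have E : (K j t x - K j s x)%:E = I by rewrite EFinB E0 addeAC subee// add0e.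
have ic c : (\int[leb]_(u in `[s, t[) cst c%:E u = (c * (t - s))%:E)%E.
  by rewrite integral_cst//= lebesgue_measure_itv/= lte_fin st -EFinB -EFinM.
rewrite -2!lee_fin E -!ic; apply/andP; split; apply: ge0_le_integral => //.
- by move=> u _; rewrite lee_fin k_ge0.
- by apply/measurable_EFinP; exact: density_measurable.
- move=> u /=; rewrite in_itv/= => /andP[su ut]; rewrite lee_fin k_ni//.
    exact: lt_le_trans su.
  exact: ltW.
- by move=> u /sub /=; rewrite in_itv/= andbT => u0; rewrite lee_fin k_ge0.
- by apply/measurable_EFinP; exact: density_measurable.
- by move=> u /=; rewrite in_itv/= => /andP[su ut]; rewrite lee_fin k_ni.
Qed.

Let quotient_le s x n : 0 < s ->
  n.+1%:R * (K j (s + n.+1%:R^-1) x - K j s x) <= k s x.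
Proof.
move=> s0; have n0 : 0 < n.+1%:R^-1 :> R by rewrite invr_gt0.
have ss : s < s + n.+1%:R^-1 by rewrite ltrDl.
have /andP[_] := K_increment x s0 ss; rewrite [X in _ * X]addrAC subrr add0r.
by rewrite ler_pdivlMr// mulrC.
Qed.

Lemma K_rderiv_has_sup s x : 0 < s ->
  has_sup (range (fun n : nat => n.+1%:R * (K j (s + n.+1%:R^-1) x - K j s x))).
Proof.
move=> s0; split; first by exists (1%:R * (K j (s + 1%:R^-1) x - K j s x)), 0%N.
by exists (k s x) => _ [n _ <-]; exact: quotient_le.
Qed.

Lemma K_rderiv_le s x : 0 < s -> K_rderiv s x <= k s x.
Proof.
move=> s0; apply: ge_sup; first by have [] := K_rderiv_has_sup x s0.
by move=> _ [n _ <-]; exact: quotient_le.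
Qed.

(** Compare [k t] with a difference quotient on an interval inside (s, t). With [K_rderiv_le] this
    squeezes the derivative between the values of [k] to the right of s and k(s), so the two differ
    only at jumps. *)
Lemma K_rderiv_ge s t x : 0 < s -> s < t -> k t x <= K_rderiv s x.
Proof.
move=> s0 st.
have [n hn] : exists n : nat, s + n.+1%:R^-1 < t.
  have /ltr_add_invr[n hn] := st; by exists n.
have n0 : 0 < n.+1%:R^-1 :> R by rewrite invr_gt0.
have ss : s < s + n.+1%:R^-1 by rewrite ltrDl.
apply: (@le_trans _ _ (n.+1%:R * (K j (s + n.+1%:R^-1) x - K j s x))).
  have /andP[h _] := K_increment x s0 ss.
  move: h; rewrite [X in _ * X]addrAC subrr add0r ler_pdivrMr// mulrC => h.
  by apply: le_trans h; apply: k_ni; [exact: lt_trans ss|exact: ltW].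
apply: ub_le_sup; last by exists n.
by have [] := K_rderiv_has_sup x s0.
Qed.

Lemma K_rderiv_ge0 s x : 0 < s -> 0 <= K_rderiv s x.
Proof.
move=> s0; have s1 : s < s + 1 by rewrite ltrDl.
apply: le_trans (K_rderiv_ge x s0 s1); apply: k_ge0; exact: lt_trans s1.
Qed.

Lemma K_rderiv_ni s t x : 0 < s -> s <= t -> K_rderiv t x <= K_rderiv s x.
Proof.
move=> s0 st; have [ts|{}st] := leP t s.
  by have -> : t = s by apply/eqP; rewrite eq_le ts.
apply: le_trans (K_rderiv_ge x s0 st); apply: K_rderiv_le; exact: lt_trans st.
Qed.

End density.

(** * Interpolation norms *)

Section power_integral.
Context {R : realType}.
Notation leb := (@lebesgue_measure R).
Implicit Types p r s : R.

Lemma continuous_powR p s : 0 < s -> {for s, continuous (fun x : R => x `^ p)}.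
Proof.
move=> s0; apply: differentiable_continuous; apply/derivable1_diffP.
by apply: derivable_powR; rewrite in_itv/= s0.
Qed.

Lemma powR_cvg_pinfty0 p : 0 < p -> (fun x : R =>
  x `^ (- p)) x @[x --> +oo] --> 0.
Proof.
move=> p0; apply/cvgr0Pnorm_lt => e e0; near=> s.
have s0 : e `^ (- p^-1) < s by near: s; exact: nbhs_pinfty_gt.
have m0 : 0 < e `^ (- p^-1) by rewrite powR_gt0.
rewrite ger0_norm ?powR_ge0// powRN.
have : (e `^ (- p^-1)) `^ p < s `^ p.
  by apply: gt0_ltr_powR => //; rewrite nnegrE ltW// (lt_trans m0).
rewrite -powRrM mulNr mulVf ?gt_eqF// powR_inv1 ?ltW// => h.
by rewrite -[ltRHS]invrK ltf_pV2// posrE ?invr_gt0// powR_gt0// (lt_trans m0).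
Unshelve. all: by end_near. Qed.

Lemma integral_powRN p r : 1 < p -> 0 < r ->
  (\int[leb]_(s in `[r, +oo[) (s `^ (- p))%:E = (r `^ (1 - p) / (p - 1))%:E)%E.
Proof.
move=> p1 r0; pose F (x : R) := - (p - 1)^-1 * x `^ (1 - p).
have q0 : 0 < p - 1 by rewrite subr_gt0.
have pos x : r <= x -> 0 < x by exact: lt_le_trans.
rewrite (@ge0_continuous_FTC2y _ (fun s => s `^ (- p)) F r 0).
- by rewrite sub0e -EFinN /F mulNr opprK mulrC.
- by move=> x _; exact: powR_ge0.
- apply/continuous_within_itvcyP; split.
    move=> x; rewrite in_itv/= andbT => rx.
    by apply: continuous_powR; exact: (lt_trans r0).
  by apply: cvg_at_right_filter; exact: continuous_powR.
- rewrite -[X in _ --> X](mulr0 (- (p - 1)^-1)); apply: cvgZr.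
  by have := powR_cvg_pinfty0 q0; rewrite opprB.
- move=> x rx; apply: derivableM; first exact: derivable_cst.
  by apply: derivable_powR; rewrite in_itv/= (lt_trans r0).
- apply: cvg_at_right_filter; apply: cvgZr; exact: continuous_powR.
- move=> x; rewrite in_itv/= andbT => rx; have x0 := lt_trans r0 rx.
  rewrite derive1E deriveZ; last by apply: derivable_powR; rewrite in_itv/= x0.
  rewrite -derive1E powR_derive1 ?in_itv/= ?x0//.
  have -> : 1 - p - 1 = - p by lra.
  by rewrite /GRing.scale/=; field; rewrite gt_eqF.
Qed.

End power_integral.

Section interpolation.
Context {R : realType} {A0 A1 : completeNormedModType R}.
Notation leb := (@lebesgue_measure R).
Variable j : {linear A1 -> A0}.
Implicit Types (r s t c theta : R) (x : A0) (a : A1).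

Lemma powRV (a p : R) : 0 <= a -> a^-1 `^ p = a `^ (- p).
Proof. by move=> a0; rewrite -(powR_inv1 a0) -powRrM mulN1r. Qed.

Lemma p_exp_gt1 theta : 0 < theta < 1 -> 1 < p_exp theta.
Proof. by move=> /andP[t0 t1]; rewrite /p_exp invf_gt1 ?subr_gt0//; lra. Qed.

Lemma p_exp_mulr theta : 0 < theta < 1 -> p_exp theta * (1 - theta) = 1.
Proof. by move=> /andP[t0 t1]; rewrite /p_exp mulVf// gt_eqF// subr_gt0. Qed.

Lemma p_exp_mull theta : 0 < theta < 1 -> theta * p_exp theta = p_exp theta - 1.
Proof. by move=> /p_exp_mulr h; lra. Qed.

Lemma K_pow_measurable p x : measurable_fun (`]0, +oo[ : set R)
  (fun s => K j s x `^ p * s `^ (- p)).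
Proof.
apply: measurable_funM; last first.
  by apply: measurable_funS (measurable_powR _) => //.
apply: (@measurableT_comp _ _ _ _ _ _ (fun y : R => y `^ p)).
  exact: measurable_powR.
rewrite -[X in measurable_fun _ X]opprK; apply/measurable_funN.
apply: nonincreasing_pos_measurable => s t s0 st.
by rewrite lerN2 K_nondecreasing// ltW.
Qed.

Lemma interp_norm_ge0 theta q x : (0 <= interp_norm j theta q x)%E.
Proof. by rewrite /interp_norm mule_ge0// ?poweR_ge0// lee_fin powR_ge0. Qed.

(** Since p (1 - theta) = 1, the constant p theta (1 - theta) is theta, and the weight s^(- theta p)
    / s is s^(-p). *)
Lemma interp_normX theta x : 0 < theta < 1 ->
  (interp_norm j theta (p_exp theta) x `^ p_exp theta =
   theta%:E * \int[leb]_(s in `]0%R, +oo[)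
     (K j s x `^ p_exp theta * s `^ (- p_exp theta))%:E)%E.
Proof.
move=> t01; have p1 := p_exp_gt1 t01; set p := p_exp theta.
have p0 : 0 < p by rewrite (lt_trans _ p1).
have pE : p * theta * (1 - theta) = theta.
  by rewrite mulrAC p_exp_mulr// mul1r.
have t0 : 0 <= theta by case/andP: t01 => /ltW.
rewrite /interp_norm poweRM ?poweR_ge0//; last by rewrite lee_fin powR_ge0.
rewrite poweR_EFin -powRrM -poweRrM mulVf ?gt_eqF// powRr1 ?pE// poweRe1.
  congr (_ * _)%E; apply: eq_integral => s; rewrite inE/= in_itv/= andbT => s0.
  congr EFin; rewrite powRM ?powR_ge0 ?K_ge0 ?ltW// -powRrM mulrAC mulrC.
  congr (_ * _); rewrite mulNr p_exp_mull// -/p -powR_inv1 ?ltW// -powRD.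
    by congr (_ `^ _); lra.
  by apply/implyP => _; rewrite gt_eqF.
apply: integral_ge0 => s; rewrite /= in_itv/= andbT => s0.
by rewrite lee_fin divr_ge0 ?powR_ge0 ?ltW.
Qed.

Let split_pos r : 0 < r -> `]0, +oo[%classic = `]0, r[ `|` `[r, +oo[ :> set R.
Proof. by move=> r0; apply: itv_bndbnd_setU; rewrite bnd_simp. Qed.

Let sub1 r : `]0, r[ `<=` (`]0, +oo[ : set R).
Proof. by move=> s /=; rewrite !in_itv/= => /andP[->]. Qed.

Let sub2 r : 0 < r -> `[r, +oo[ `<=` (`]0, +oo[ : set R).
Proof. by move=> r0 s /=; rewrite !in_itv/= !andbT; exact: lt_le_trans. Qed.

Let split_integral p r x : 0 < r ->
  (\int[leb]_(s in `]0%R, +oo[) (K j s x `^ p * s `^ (- p))%:E =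
   \int[leb]_(s in `]0%R, r[) (K j s x `^ p * s `^ (- p))%:E +
   \int[leb]_(s in `[r, +oo[) (K j s x `^ p * s `^ (- p))%:E)%E.
Proof.
move=> r0; rewrite (split_pos r0) ge0_integral_setU//=.
- by rewrite -(split_pos r0); apply/measurable_EFinP; exact: K_pow_measurable.
- by move=> s _; rewrite lee_fin mulr_ge0// powR_ge0.
- apply/disj_setPS => u /=; rewrite !in_itv/= andbT => -[/andP[_ us] su].
  by move: su; rewrite leNgt us.
Qed.

Let int_cst r c : 0 < r ->
  (\int[leb]_(s in `]0%R, r[) (cst c%:E s) = (c * r)%:E)%E.
Proof.
by move=> r0; rewrite integral_cst//= lebesgue_measure_itv/= lte_fin r0 oppr0
  adde0.
Qed.

Let int_powZ p r c : 1 < p -> 0 < r -> 0 <= c ->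
  (\int[leb]_(s in `[r, +oo[) (c * s `^ (- p))%:E = (c * (r `^ (1 - p) / (p -
    1)))%:E)%E.
Proof.
move=> p1 r0 c0; rewrite EFinM -integral_powRN// -ge0_integralZl_EFin//.
- by move=> s _; rewrite lee_fin powR_ge0.
- by apply/measurable_EFinP; apply: measurable_funS (measurable_powR _).
Qed.

(** K dominates K(r) min(s / r, 1), whose integral is computed exactly on both sides of r; the
    constant is theta (1 + 1 / (p - 1)) = 1. *)
Lemma interp_norm_lower theta r x : 0 < theta < 1 -> 0 < r ->
  ((K j r x `^ p_exp theta * r `^ (1 - p_exp theta))%:E <=
   interp_norm j theta (p_exp theta) x `^ p_exp theta)%E.
Proof.
move=> t01 r0; have p1 := p_exp_gt1 t01; have pt := p_exp_mull t01.
rewrite interp_normX//; set p := p_exp theta in p1 pt *.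
have t0 : 0 <= theta by case/andP: t01 => /ltW.
have p0 : 0 < p by rewrite (lt_trans _ p1).
have q0 : 0 < p - 1 by rewrite subr_gt0.
have Kr0 := K_ge0 j x (ltW r0).
rewrite (split_integral p x r0).
have -> : K j r x `^ p * r `^ (1 - p) =
    theta * ((K j r x / r) `^ p * r + K j r x `^ p * (r `^ (1 - p) / (p - 1))).
  rewrite powRM ?invr_ge0 ?(ltW r0)// powRV ?(ltW r0)//.
  have -> : r `^ (1 - p) = r * r `^ (- p).
    by rewrite powRD ?powRr1 ?ltW//; apply/implyP => _; rewrite gt_eqF.
  have -> : theta = (p - 1) / p by rewrite -pt mulfK ?gt_eqF.
  by field; rewrite !gt_eqF.
rewrite EFinM EFinD lee_wpmul2l// leeD//.
- rewrite -int_cst//; apply: ge0_le_integral => //.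
  + by move=> s _; rewrite lee_fin powR_ge0.
  + apply/measurable_EFinP; apply: (measurable_funS _ (@sub1 r)
    (K_pow_measurable p x)) => //.
  + move=> s /=; rewrite in_itv/= => /andP[s0 sr]; rewrite lee_fin.
    rewrite -powRV ?(ltW s0)//.
    have Ks0 := K_ge0 j x (ltW s0).
    rewrite -powRM// ?invr_ge0 ?(ltW s0)//.
    apply: ge0_ler_powR; rewrite ?nnegrE ?divr_ge0 ?(ltW r0) ?(ltW s0) ?(ltW
      p0)//.
    rewrite ler_pdivrMr// mulrAC ler_pdivlMr//.
    by have := K_quasiconcave j x s0 (ltW sr); rewrite mulrC [r * _]mulrC.
- rewrite -(int_powZ p1 r0 (powR_ge0 _ p)); apply: ge0_le_integral => //.
  + by move=> s _; rewrite lee_fin mulr_ge0 ?powR_ge0.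
  + apply/measurable_EFinP; apply: measurable_funM => //.
    exact: measurable_funS (measurable_powR _).
  + by apply/measurable_EFinP; apply: (measurable_funS _ (sub2 r0)
    (K_pow_measurable p x)).
  + move=> s /=; rewrite in_itv/= andbT => rs;
    rewrite lee_fin ler_wpM2r ?powR_ge0//.
    have Ks0 := K_ge0 j x (le_trans (ltW r0) rs).
    apply: ge0_ler_powR; rewrite ?nnegrE ?(ltW p0)//.
    exact: K_nondecreasing (ltW r0) rs.
Qed.

(** Either K(r) <= c r, or K(r) = K(r)^p K(r)^(1 - p) <= K(r)^p (c r)^(1 - p), since 1 - p < 0;
    [interp_norm_lower] bounds the latter. *)
Lemma K_excess_le_interp theta r c x : 0 < theta < 1 -> 0 < r -> 0 < c ->
  ((K j r x)%:E <= (c * r)%:E + (c `^ (1 - p_exp theta))%:E *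
     interp_norm j theta (p_exp theta) x `^ p_exp theta)%E.
Proof.
move=> t01 r0 c0; have p1 := p_exp_gt1 t01;
  have h := interp_norm_lower x t01 r0.
set p := p_exp theta in p1 h *.
have X0 : (0 <= (c `^ (1 - p))%:E * interp_norm j theta p x `^ p)%E.
  by rewrite mule_ge0// ?poweR_ge0// lee_fin powR_ge0.
have [Kc|cK] := leP (K j r x) (c * r).
  by rewrite -[leLHS]adde0 leeD.
rewrite -[leLHS]add0e leeD//; first by rewrite lee_fin mulr_ge0// ltW.
have K0 : 0 < K j r x by rewrite (lt_trans _ cK)// mulr_gt0.
apply: le_trans (lee_wpmul2l _ h); last by rewrite lee_fin powR_ge0.
rewrite -EFinM lee_fin mulrCA -powRM ?(ltW c0) ?(ltW r0)//.
have -> : (c * r) `^ (1 - p) = ((c * r) `^ (p - 1))^-1 by rewrite -powRN opprB.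
rewrite ler_pdivlMr ?powR_gt0 ?mulr_gt0//.
rewrite -[leRHS]mulr_powRB1 ?(ltW K0) ?(lt_trans _ p1)// ler_pM2l//.
by apply: ge0_ler_powR; rewrite ?nnegrE ?subr_ge0 ?ltW ?mulr_gt0.
Qed.

(** The integral of min(A, B s)^p s^(-p), split at the crossing point s = A / B, gives exactly the
    right-hand side. *)
Lemma interp_norm_upper theta x (A B : R) : 0 < theta < 1 -> 0 <= A -> 0 < B ->
  (forall s, 0 < s -> K j s x <= A) -> (forall s, 0 < s -> K j s x <= B * s) ->
  (interp_norm j theta (p_exp theta) x `^ p_exp theta <=
   (A * B `^ (p_exp theta - 1))%:E)%E.
Proof.
move=> t01 A0' B0 KA KB; have p1 := p_exp_gt1 t01; have pt := p_exp_mull t01.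
rewrite interp_normX//; set p := p_exp theta in p1 pt *.
have p0 : 0 < p by rewrite (lt_trans _ p1).
have q0 : 0 < p - 1 by rewrite subr_gt0.
have t0 : 0 <= theta by case/andP: t01 => /ltW.
(* For A = 0 the crossing point degenerates to 0, but then K vanishes. *)
have [A00|A_gt0] := leP A 0.
  have A00' : A = 0 by apply/eqP; rewrite eq_le A00.
  rewrite A00' mul0r integral0_eq ?mule0// => s /=;
    rewrite in_itv/= andbT => s0.
  have -> : K j s x = 0.
    by apply/eqP; rewrite eq_le (K_ge0 _ _ (ltW s0)) andbT -A00' KA.
  by rewrite powR0 ?gt_eqF// mul0r.
have r0 : 0 < A / B by rewrite divr_gt0.
rewrite (split_integral p x r0).
have -> : A * B `^ (p - 1) =
    theta * (B `^ p * (A / B) + A `^ p * ((A / B) `^ (1 - p) / (p - 1))).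
  have BE : B `^ p = B * B `^ (p - 1) by rewrite mulr_powRB1 ?ltW.
  have -> : (A / B) `^ (1 - p) = B `^ (p - 1) / A `^ (p - 1).
    rewrite powRM ?invr_ge0 ?(ltW B0) ?(ltW A_gt0)// powRV ?(ltW B0)// opprB
      mulrC.
    by rewrite -powRN opprB.
  have AE : A `^ p = A * A `^ (p - 1) by rewrite mulr_powRB1 ?ltW.
  have Ap : A `^ (p - 1) != 0 by rewrite gt_eqF// powR_gt0.
  rewrite AE BE; have -> : theta = (p - 1) / p by rewrite -pt mulfK ?gt_eqF.
  by field; rewrite Ap !gt_eqF.
rewrite EFinM EFinD lee_wpmul2l// leeD//.
- rewrite -int_cst//; apply: ge0_le_integral => //.
  + by move=> s _; rewrite lee_fin mulr_ge0 ?powR_ge0.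
  + by apply/measurable_EFinP; apply: (measurable_funS _ (@sub1 (A / B))
    (K_pow_measurable p x)).
  + move=> s /=; rewrite in_itv/= => /andP[s0 sr]; rewrite lee_fin.
    rewrite -powRV ?(ltW s0)//.
    have Ks0 := K_ge0 j x (ltW s0).
    rewrite -powRM// ?invr_ge0 ?(ltW s0)//.
    apply: ge0_ler_powR; rewrite ?nnegrE ?divr_ge0 ?(ltW s0) ?(ltW p0) ?(ltW
      B0)//.
    by rewrite ler_pdivrMr// KB.
- rewrite -(int_powZ p1 r0 (powR_ge0 _ p)); apply: ge0_le_integral => //.
  + by move=> s _; rewrite lee_fin mulr_ge0 ?powR_ge0.
  + by apply/measurable_EFinP; apply: (measurable_funS _ (sub2 r0)
    (K_pow_measurable p x)).
  + apply/measurable_EFinP; apply: measurable_funM => //.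
    exact: measurable_funS (measurable_powR _).
  + move=> s /=; rewrite in_itv/= andbT => rs;
    rewrite lee_fin ler_wpM2r ?powR_ge0//.
    have s0 := lt_le_trans r0 rs.
    by apply: ge0_ler_powR; rewrite ?nnegrE ?(ltW p0) ?K_ge0 ?KA// ltW.
Qed.

Lemma interp_norm0 theta : 0 < theta < 1 ->
  interp_norm j theta (p_exp theta) 0 = 0%E.
Proof.
move=> t01; apply: (@poweR_eq0_eq0 _ _ (p_exp theta));
  first exact: interp_norm_ge0.
apply/eqP; rewrite eq_le poweR_ge0 andbT.
have K00 s : 0 < s -> K j s 0 <= 0.
  by move=> s0; have := K_le_norm j 0 (ltW s0); rewrite normr0.
apply: le_trans (interp_norm_upper t01 (lexx 0) ltr01 K00 _) _;
  last by rewrite mul0r.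
by move=> s s0; rewrite mul1r (le_trans (K00 s s0))// ltW.
Qed.

Hypothesis j_le : forall a, `|j a| <= `|a|.

(** The lower bound at r = 1, where K is the norm of A0. *)
Lemma norm_le_interp theta x : 0 < theta < 1 ->
  (`|x|%:E <= interp_norm j theta (p_exp theta) x)%E.
Proof.
move=> t01; have p1 := p_exp_gt1 t01; have := interp_norm_lower x t01 ltr01.
have p0 : 0 < p_exp theta by rewrite (lt_trans _ p1).
rewrite powR1 mulr1 K_norm// -poweR_EFin => h.
have := @gt0_ler_poweR _ (p_exp theta)^-1 _ _ _ _ _ h.
rewrite -!poweRrM mulfV ?gt_eqF// !poweRe1 ?interp_norm_ge0//.
apply; [by rewrite invr_ge0 ltW|by rewrite in_itv/= leey andbT lee_fin
  powR_ge0|].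
by rewrite in_itv/= leey andbT poweR_ge0.
Qed.

Lemma interp_norm_image theta a : 0 < theta < 1 ->
  (interp_norm j theta (p_exp theta) (j a) < +oo)%E.
Proof.
move=> t01; have p1 := p_exp_gt1 t01.
have p0 : 0 < p_exp theta by rewrite (lt_trans _ p1).
apply: (@lty_poweRy _ _ (p_exp theta)); first by rewrite gt_eqF.
(* [interp_norm_upper] asks for a positive slope, while [a] may be 0. *)
have b0 : 0 < `|a| + 1 by rewrite ltr_wpDl.
have h1 s : 0 < s -> K j s (j a) <= `|j a| by move=> s0;
  rewrite K_le_norm// ltW.
have h2 s : 0 < s -> K j s (j a) <= (`|a| + 1) * s.
  move=> s0; apply: le_trans (K_image j a (ltW s0)) _.
  by rewrite mulrC ler_pM2r// lerDl.
exact: le_lt_trans (interp_norm_upper t01 (normr_ge0 _) b0 h1 h2) (ltry _).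
Qed.

End interpolation.

(** * Simple functions and measurability in a parameter *)

Section lower_integral.
Local Open Scope ereal_scope.
Context d (T : measurableType d) (R : realType).
Variable mu : {measure set T -> \bar R}.
Implicit Types f g : T -> \bar R.

Lemma negligible_ae (P : T -> Prop) (A : set T) : mu.-negligible A ->
  (forall x, ~ P x -> A x) -> {ae mu, forall x, P x}.
Proof. by move=> [N [mN N0 AN]] PA; exists N; split => // x /PA/AN. Qed.

Lemma ae_impl2 (P Q S : T -> Prop) : (forall x, P x -> Q x -> S x) ->
  {ae mu, forall x, P x} -> {ae mu, forall x, Q x} -> {ae mu, forall x, S x}.
Proof. by move=> PQS; apply: filterS2. Qed.

Lemma ge0_le_integralT f g : (forall x, 0 <= f x) -> (forall x, f x <= g x) ->
  \int[mu]_x f x <= \int[mu]_x g x.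
Proof.
move=> f0 fg; have g0 x : 0 <= g x by exact: le_trans (f0 x) (fg x).
rewrite !ge0_integralTE//; apply: le_ereal_sup => _ [h hf <-].
by exists h => // x; exact: le_trans (fg x).
Qed.

Import HBNNSimple.

(* No measurability is needed: the integral of a nonnegative function is the
   supremum of the integrals of the simple functions below it. *)
Lemma ae_ge0_le_integralT f g : (forall x, 0 <= f x) -> (forall x, 0 <= g x) ->
  {ae mu, forall x, f x <= g x} -> \int[mu]_x f x <= \int[mu]_x g x.
Proof.
move=> f0 g0 [N [mN N0 fgN]].
rewrite (ge0_integralTE _ f0); apply: ge_ereal_sup => _ [h hf <-].
have mh : measurable_fun setT (EFin \o h) by exact/measurable_EFinP.
have h0 w : setT w -> 0 <= (EFin \o h) w by rewrite lee_fin.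
rewrite -integralT_nnsfun (ge0_negligible_integral mN measurableT mh h0 N0).
rewrite integral_mkcond; apply: ge0_le_integralT => x.
  by apply: erestrict_ge0 => y _; rewrite lee_fin.
rewrite patchE; case: ifPn => //; rewrite inE/= => -[_ xN].
apply: le_trans (hf x) _; apply: contrapT => h1; apply: xN; apply: fgN.
exact: h1.
Qed.

Lemma ae_eq_integralT f g : (forall x, 0 <= f x) -> (forall x, 0 <= g x) ->
  {ae mu, forall x, f x = g x} -> \int[mu]_x f x = \int[mu]_x g x.
Proof.
move=> f0 g0 fg; apply/eqP; rewrite eq_le; apply/andP; split;
  apply: ae_ge0_le_integralT => //; apply: filterS fg => x ->//.
Qed.

End lower_integral.

Section simple_maps.
Context d (T : measurableType d).

(** Unlike in [simple_function] no norm is involved, so values may also be pairs, booleans or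
    options. *)
Definition simple_map {X : Type} (s : T -> X) :=
  finite_set (range s) /\ forall v, measurable (s @^-1` [set v]).

Lemma simple_map_preimage X (s : T -> X) (A : set X) : simple_map s ->
  measurable (s @^-1` A).
Proof.
move=> [fs ms].
rewrite (_ : _ @^-1` _ = \bigcup_(v in range s `&` A) s @^-1` [set v]).
  apply: fin_bigcup_measurable => //.
  by apply: sub_finite_set fs; exact: subIsetl.
apply/seteqP; split => [w Aw|w [v [_ Av]] /= ->//].
by exists (s w) => //; split => //; exists w.
Qed.

Lemma simple_map_comp X Y (F : X -> Y) (s : T -> X) : simple_map s ->
  simple_map (F \o s).
Proof.
move=> ss; split; last by move=> v; rewrite comp_preimage;
  exact: simple_map_preimage.
by case: ss => fs _; rewrite -(image_comp s F); exact: finite_image.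
Qed.

Lemma simple_map_pair X Y (s : T -> X) (t : T -> Y) : simple_map s ->
  simple_map t -> simple_map (fun w => (s w, t w)).
Proof.
move=> ss st; split.
  apply: (@sub_finite_set _ _ (range s `*` range t)).
    by move=> _ [w _ <-]; split; exists w.
  by apply: finite_setX; [exact: ss.1|exact: st.1].
move=> [x y].
rewrite (_ : _ @^-1` _ = (s @^-1` [set x]) `&` (t @^-1` [set y])).
  by apply: measurableI; [exact: ss.2|exact: st.2].
by apply/seteqP; split => [w [<- <-]|w /= [-> ->]].
Qed.

Lemma simple_map_comp2 X Y Z (F : X -> Y -> Z) (s : T -> X) (t : T -> Y) :
  simple_map s -> simple_map t -> simple_map (fun w => F (s w) (t w)).
Proof.
by move=> ss st; exact: (simple_map_comp (fun z =>
  F z.1 z.2) (simple_map_pair ss st)).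
Qed.

Lemma simple_map_cst X (x : X) : simple_map (fun=> x : X).
Proof.
split; first by apply: (sub_finite_set _ (finite_set1 x)) => _ [w _ <-].
by move=> v; rewrite preimage_cst; case: ifP.
Qed.

Lemma simple_map_bool (A : set T) : measurable A ->
  simple_map (fun w => `[< A w >]).
Proof.
move=> mA; split; first exact: finite_finset.
move=> b; rewrite [X in measurable X](_ : _ = if b then A else ~` A).
  by case: b => //; exact: measurableC.
apply/seteqP; split => w /=; first by move=> <-; case: asboolP.
by case: b => Aw; apply/asboolP.
Qed.

Lemma simple_map_measurable d' (X : measurableType d') (s : T -> X) :
  simple_map s -> measurable_fun setT s.
Proof. by move=> ss _ B _; rewrite setTI; exact: simple_map_preimage. Qed.

End simple_maps.

Section simple_limits.
Context {R : realType} d (T : measurableType d).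
Variable mu : {measure set T -> \bar R}.
Variable V : normedModType R.
Implicit Types f g : T -> V.

(** Convergence is required everywhere, so that what is built from the limit is measurable and not
    only almost everywhere equal to something measurable. *)
Definition simple_limit f := exists2 s : nat -> T -> V,
  (forall n, simple_map (s n)) & (forall w, s n w @[n --> \oo] --> f w).

Lemma simple_limit_simple f : simple_map f -> simple_limit f.
Proof. by move=> sf; exists (fun=> f) => // w; exact: cvg_cst. Qed.

Lemma simple_limitD f g : simple_limit f -> simple_limit g ->
  simple_limit (fun w => f w + g w).
Proof.
move=> [s ss sf] [t st tg]; exists (fun n w => s n w + t n w).
  by move=> n; apply: simple_map_comp2.
by move=> w; apply: cvgD.
Qed.

Lemma simple_limitN f : simple_limit f -> simple_limit (fun w => - f w).
Proof.
move=> [s ss sf]; exists (fun n w => - s n w).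
  by move=> n; apply: (simple_map_comp (fun x : V => - x)).
by move=> w; apply: cvgN.
Qed.

Lemma simple_limitB f g : simple_limit f -> simple_limit g ->
  simple_limit (fun w => f w - g w).
Proof. by move=> sf /simple_limitN; exact: simple_limitD. Qed.

Lemma simple_limit_sum (I : Type) (l : seq I) (F : I -> T -> V) :
  (forall i, simple_limit (F i)) -> simple_limit (fun w => \sum_(i <- l) F i w).
Proof.
move=> sF; elim: l => [|i l IH].
  under eq_fun do rewrite big_nil.
  by apply: simple_limit_simple; exact: simple_map_cst.
by under eq_fun do rewrite big_cons; exact: simple_limitD.
Qed.

Lemma simple_limit_norm f : simple_limit f -> measurable_fun setT (fun w =>
  `|f w|).
Proof.
move=> [s ss sf].
apply: (measurable_fun_cvg (h := fun n w => `|s n w|)).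
  move=> n; apply: simple_map_measurable.
  exact: (simple_map_comp (fun x : V => `|x|)).
by move=> w _; apply: cvg_norm.
Qed.

End simple_limits.

Section representatives.
Context {R : realType} d (T : measurableType d).
Variable mu : {measure set T -> \bar R}.
Variable V : normedModType R.
Implicit Types (f g : T -> V) (N : V -> \bar R).

(** Function and approximants are set to 0 on the null set where convergence may fail; since [N]
    dominates the norm, the rest converges in norm. *)
Lemma strongly_measurable_rep N f : (forall x, (`|x|%:E <= N x)%E) ->
  strongly_measurable mu N f ->
  exists2 g, simple_limit g & {ae mu, forall w, f w = g w}.
Proof.
move=> leN [s ss [Z [mZ Z0 sZ]]].
pose g w := if `[< Z w >] then 0 else f w.
exists g; last first.
  exists Z; split => // w /= h; apply: contrapT => nZ; apply: h.
  by rewrite /g; case: asboolP.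
exists (fun n w => if `[< Z w >] then 0 else s n w).
  move=> n; have sn : simple_map (s n) by have [h1 h2 _] := ss n; split.
  exact: (simple_map_comp2 (fun b x => if b then 0 else x)
    (simple_map_bool mZ) sn).
move=> w; rewrite /g; case: asboolP => [_|nZ]; first exact: cvg_cst.
have cw : (N (f w - s n w)%R @[n --> \oo] --> 0)%E.
  by apply: contrapT => h; apply: nZ; exact: sZ.
apply/cvgrPdist_lt => e e0.
have /fine_cvgP[fin /cvgr0Pnorm_lt/(_ e e0)] := cw.
apply: filterS2 fin => n fn; apply: le_lt_trans.
rewrite -lee_fin; apply: le_trans (leN _) _.
by rewrite -[X in (X <= _)%E]fineK// lee_fin ler_norm.
Qed.

Lemma strongly_measurable_simple_limit f g : simple_limit g ->
  {ae mu, forall w, f w = g w} -> strongly_measurable mu (fun x => `|x|%:E) f.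
Proof.
move=> [s ss sg] fg; exists s.
  by move=> n; have [h1 h2] := ss n; split => // w; rewrite ltry.
apply: filterS fg => w ->; apply: cvg_EFin; first exact: nearW.
by apply/norm_cvg0P; rewrite -(subrr (g w)); apply: cvgB => //; exact: cvg_cst.
Qed.

End representatives.

(** * Measurability in the point and in s jointly *)

Section joint_measurability.
Context {R : realType} d (T : measurableType d).
Context {A0 A1 : completeNormedModType R}.
Variable j : {linear A1 -> A0}.

Lemma simple_map_joint_measurable X (s : T -> X) (F : R -> X -> R) :
  simple_map s -> (forall x, measurable_fun setT (F^~ x)) ->
  measurable_fun setT (fun z : T * R => F z.2 (s z.1)).
Proof.
move=> [fs ms] mF _ B mB; rewrite setTI.
rewrite (_ : _ @^-1` _ =
   \bigcup_(v in range s) ((s @^-1` [set v]) `*` ((F^~ v) @^-1` B))).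
  apply: fin_bigcup_measurable => // v _; apply: measurableX => //.
  by rewrite -[X in measurable X]setTI; exact: mF.
apply/seteqP; split => [[w t] /= h|[w t] /= [_ [u _ <-]] /= [-> ]//].
by exists (s w) => //; exists w.
Qed.

(** The truncation at 0 makes K monotone in t, and Lipschitz in x, for all real t. *)
Definition K_pos t x := K j (Num.max t 0) x.

Lemma K_posE t x : 0 < t -> K_pos t x = K j t x.
Proof. by move=> t0; rewrite /K_pos max_l// ltW. Qed.

(** For a simple map, monotonicity in t suffices for each of the finitely many values; the Lipschitz
    bound in x then allows the passage to the limit. *)
Lemma K_joint_measurable (f : T -> A0) : simple_limit f ->
  measurable_fun setT (fun z : T * R => K_pos z.2 (f z.1)).
Proof.
move=> [s ss sf].
apply: (measurable_fun_cvg (h := fun n (z : T * R) => K_pos z.2 (s n z.1))).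
  move=> n; apply: simple_map_joint_measurable => // x.
  apply: nondecreasing_measurable => // a b ab; apply: K_nondecreasing.
    by rewrite le_max lexx orbT.
  by rewrite ge_max !le_max ab lexx !orbT.
move=> [w t] _ /=; apply/cvgrPdist_le => e e0.
have := sf w => /cvgrPdist_le /(_ e e0); apply: filterS => n.
by apply: le_trans; apply: K_lip; rewrite le_max lexx orbT.
Qed.

Lemma K_rderiv_joint_measurable (k : R -> A0 -> R) (f : T -> A0) :
  is_K_density j k -> (forall a, `|j a| <= `|a|) -> simple_limit f ->
  measurable_fun ([set: T] `*` `]0%R, +oo[ : set (T * R)) (fun z : T * R =>
    K_rderiv j z.2 (f z.1)).
Proof.
move=> kd jle sf.
pose h n (z : T * R) :=
  n.+1%:R * (K_pos (z.2 + n.+1%:R^-1) (f z.1) - K_pos z.2 (f z.1)).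
have hE (z : T * R) : 0 < z.2 -> range (h^~ z) =
  range (fun n : nat => n.+1%:R * (K j (z.2
    + n.+1%:R^-1) (f z.1) - K j z.2 (f z.1))).
  move=> z0; congr image; apply/funext => n; rewrite /h !K_posE//.
  by rewrite addr_gt0.
apply: (@eq_measurable_fun _ _ _ _ _ (fun z => sups (h^~ z) 0)).
  move=> z; rewrite inE /= in_itv/= andbT => -[_ z0].
  rewrite /K_rderiv -hE// /sups/=; congr sup; apply/seteqP; split => y [n].
    by move=> _ <-; exists n.
  by move=> _ <-; exists n.
apply: measurable_fun_sups.
  move=> z /=; rewrite in_itv/= andbT => -[_ z0]; rewrite hE//.
  by have [] := K_rderiv_has_sup kd (f z.1) z0.
move=> n; apply: measurable_funTS.
apply: measurable_funM => //; apply: measurable_funB;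
  last exact: K_joint_measurable.
pose g (z : T * R) := (z.1, z.2 + n.+1%:R^-1).
apply: (measurableT_comp (K_joint_measurable sf) (_ : measurable_fun setT g)).
apply/measurable_fun_pairP; split; first exact: measurable_fst.
exact: (measurable_funD measurable_snd (measurable_cst _)).
Qed.

End joint_measurability.

(** * Agreement of the density with its measurable version *)

Section ae_density.
Context {R : realType} d (T : measurableType d).
Variable mu : {finite_measure set T -> \bar R}.
Context {A0 A1 : completeNormedModType R}.
Notation leb := (@lebesgue_measure R).
Variable j : {linear A1 -> A0}.
Variable k : R -> A0 -> R.
Hypothesis k_dens : is_K_density j k.
Hypothesis j_le : forall a, `|j a| <= `|a|.

Lemma interp_normX_measurable theta (f : T -> A0) : 0 < theta < 1 ->
  simple_limit f -> measurable_fun setT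
    (fun w => interp_norm j theta (p_exp theta) (f w) `^ p_exp theta)%E.
Proof.
move=> t01 sf; under eq_fun do rewrite interp_normX//.
apply: measurable_funeM.
(* The indicator moves the half line into the integrand, so that Tonelli applies on the whole
   product. *)
pose F (z : T * R) :=
  (\1_(`]0, +oo[ : set R) z.2 * (K_pos j z.2 (f z.1) `^ p_exp theta * z.2 `^ (-
    p_exp theta)))%:E.
have mF : measurable_fun setT F.
  apply/measurable_EFinP; apply: measurable_funM.
    by apply: measurableT_comp; [exact: measurable_indic|exact: measurable_snd].
  apply: measurable_funM.
    apply: (measurableT_comp (measurable_powR _)); exact: K_joint_measurable.
  by apply: (measurableT_comp (measurable_powR _)); exact: measurable_snd.
have F0 z : (0 <= F z)%E by rewrite lee_fin !mulr_ge0 ?powR_ge0.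
apply: (eq_measurable_fun (fubini_F leb F));
  last exact: measurable_fun_fubini_tonelli_F.
move=> w _; rewrite /fubini_F [RHS]integral_mkcond; apply: eq_integral => s _.
rewrite patchE /F indicE; case: ifPn => [|_]; last by rewrite mul0r.
by rewrite inE/= in_itv/= andbT => s0; rewrite mul1r K_posE.
Qed.

(** An enumeration of the rationals; 0 stands in for numbers that encode none. *)
Let ratn (n : nat) : R := ratr (odflt 0 (unpickle n)).

Let ratn_between (a b : R) : a < b -> exists n, a < ratn n < b.
Proof.
move=> /rat_in_itvoo[q]; rewrite in_itv/= => h.
by exists (pickle q); rewrite /ratn pickleK.
Qed.

(** Where the two differ, some rational lies strictly between them. A given rational does so at one
    point at most: s < t would give k(t) <= [K_rderiv j s x] < rational < k(t). *)
Lemma density_ae_eq x : {ae leb, forall s, 0 < s -> k s x = K_rderiv j s x}.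
Proof.
apply: (@negligible_ae _ _ _ leb _
    (\bigcup_n [set s | 0 < s /\ K_rderiv j s x < ratn n < k s x])).
  apply: negligible_bigcup => n.
  set B := [set s | _].
  have [[r Br]|nB] := pselect (exists r, B r); last first.
    rewrite (_ : B = set0); first exact: negligible_set0.
    by apply/seteqP; split => // s Bs; apply: nB; exists s.
  exists [set r]; split; [exact: measurable_set1|exact: lebesgue_measure_set1|].
  have lem s t : B s -> B t -> s < t -> False.
    move=> [s0 /andP[h _]] [t0 /andP[_ h']] st.
    have := lt_le_trans (lt_trans h h') (K_rderiv_ge k_dens x s0 st).
    by rewrite ltxx.
  move=> s Bs /=; case: (ltgtP s r) => // h.
    by have := lem _ _ Bs Br h.
  by have := lem _ _ Br Bs h.
move=> s /= /not_implyP[s0 /eqP ne].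
have : K_rderiv j s x < k s x.
  by rewrite lt_neqAle (K_rderiv_le k_dens)// andbT eq_sym.
by move=> /ratn_between[n hn]; exists n.
Qed.

Variable f : T -> A0.
Hypothesis sf : simple_limit f.

(** Extended by 0 to s <= 0, to be measurable on the whole product. *)
Definition K_rderiv_of (z : T * R) :=
  if 0 < z.2 then K_rderiv j z.2 (f z.1) else 0.

Lemma K_rderiv_of_measurable : measurable_fun setT K_rderiv_of.
Proof.
have mD : measurable ([set: T] `*` `]0%R, +oo[ : set (T * R))
  by exact: measurableX.
have := (measurable_restrictT _ mD).1 (K_rderiv_joint_measurable k_dens j_le
  sf).
congr measurable_fun; apply/funext => z; rewrite patchE /K_rderiv_of.
have -> // : (z \in [set: T] `*` `]0%R, +oo[%classic) = (0 < z.2).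
by apply/idP/idP; rewrite inE/= in_itv/= andbT; [case|split].
Qed.

Lemma K_rderiv_of_ge0 z : 0 <= K_rderiv_of z.
Proof. by rewrite /K_rderiv_of; case: ifPn => // z0;
  exact: (K_rderiv_ge0 k_dens). Qed.

(* [k] may fail to be jointly measurable, but it differs from [K_rderiv] only at
   jumps of the latter, and these are detected
     by countably many inequalities. *)
Lemma density_joint_ae_eq :
  {ae (mu \x leb)%E, forall z, 0 < z.2 -> k z.2 (f z.1) = K_rderiv_of z}.
Proof.
(* The points s c(m) increase to s, and express the left limit at s by countably many values. *)
pose c (m : nat) : R := m.+1%:R / m.+2%:R.
have c0 m : 0 < c m by rewrite divr_gt0.
have c1 m : c m < 1 by rewrite ltr_pdivrMr// mul1r ltr_nat.
have cc a b : 0 < a -> a < b -> exists m, a < b * c m.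
  move=> a0 ab; have b0 := lt_trans a0 ab.
  have [m hm] : exists m : nat, a / b + m.+1%:R^-1 < 1.
    have /ltr_add_invr[m hm] : a / b < 1 by rewrite ltr_pdivrMr// mul1r.
    by exists m.
  exists m; rewrite mulrC -ltr_pdivrMr//.
  apply: (@lt_le_trans _ _ (1 - m.+1%:R^-1)); first by rewrite ltrBrDr.
  rewrite /c ler_pdivlMr// mulrBl mul1r.
  have -> : m.+2%:R = m.+1%:R + 1 :> R by rewrite -[m.+2]addn1 natrD.
  have : 0 < m.+1%:R :> R by [].
  move: (m.+1%:R : R) => y y0; have : y^-1 * y = 1 by rewrite mulVf// gt_eqF.
  have : 0 <= y^-1 by rewrite invr_ge0 ltW.
  lra.
(* [B n] collects the jumps of the derivative across the n-th rational. It does not mention [k],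
   hence is measurable. *)
pose B n := [set z : T * R | 0 < z.2] `&` [set z | K_rderiv_of z < ratn n] `&`
  \bigcap_m [set z | ratn n <= K_rderiv_of (z.1, z.2 * c m)].
have mB n : measurable (B n).
  have mG := K_rderiv_of_measurable.
  apply: measurableI; first apply: measurableI.
  - rewrite -[X in measurable X]setTI (_ : [set z | _] = snd @^-1` `]0, +oo[).
      exact: measurable_snd.
    by apply/seteqP; split => z /=; rewrite in_itv/= andbT.
  - rewrite -[X in measurable X]setTI (_ : [set z | _] = K_rderiv_of @^-1`
    `]-oo, ratn n[).
      exact: mG.
    by apply/seteqP; split => z /=; rewrite in_itv/=.
  - apply: bigcap_measurable => // m _.
    pose g (z : T * R) := (z.1, z.2 * c m).
    have mg : measurable_fun setT g.
      apply/measurable_fun_pairP; split; first exact: measurable_fst.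
      exact: (measurable_funM measurable_snd (measurable_cst _)).
    rewrite -[X in measurable X]setTI
      (_ : [set z | _] = (K_rderiv_of \o g) @^-1` `[ratn n, +oo[).
      exact: (measurableT_comp mG mg).
    by apply/seteqP; split => z /=; rewrite in_itv/= andbT.
(* Each section of [B n] has at most one point: for s < t, some t c(m) lies beyond s, where the
   derivative is already below the rational. *)
have lem n w s t : B n (w, s) -> B n (w, t) -> s < t -> False.
  move=> [[/= s0 h] _] [[/= t0 _] h'] st.
  have [m hm] := cc s t s0 st.
  have := h' m I => /=.
  rewrite leNgt => /negP; apply; apply: le_lt_trans h.
  rewrite /K_rderiv_of/= s0 mulr_gt0//.
  exact: (K_rderiv_ni k_dens _ s0 (ltW hm)).
apply: (@negligible_ae _ _ _ (mu \x leb)%E _ (\bigcup_n B n)).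
  apply: negligible_bigcup => n; exists (B n); split; [exact: mB| |by []].
  rewrite /product_measure1/=. apply: integral0_eq => w _ /=.
  have [[r Br]|nB] := pselect (exists r, B n (w, r)); last first.
    rewrite (_ : xsection _ _ = set0) ?measure0//.
    by apply/seteqP; split => // s; rewrite /xsection/= inE => h; apply: nB;
      exists s.
  apply/eqP; rewrite eq_le measure_ge0 andbT -(lebesgue_measure_set1 r).
  apply: le_measure; rewrite ?inE;
    [exact: measurable_xsection (mB n)|exact: measurable_set1|].
  move=> s; rewrite /xsection/= inE => Bs.
  case: (ltgtP s r) => // h.
    by have := lem _ _ _ _ Bs Br h.
  by have := lem _ _ _ _ Br Bs h.
move=> [w s] /= /not_implyP[s0]; rewrite /K_rderiv_of/= s0 => /eqP ne.
have : K_rderiv j s (f w) < k s (f w).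
  by rewrite lt_neqAle (K_rderiv_le k_dens)// andbT eq_sym.
move=> /ratn_between[n /andP[h1 h2]]; exists n => //; split.
  by split => //=; rewrite /K_rderiv_of/= s0.
move=> m _ /=; rewrite /K_rderiv_of/= mulr_gt0//.
apply/ltW/(lt_le_trans h2); apply: (K_rderiv_ge k_dens);
  first by rewrite mulr_gt0.
by rewrite gtr_pMr.
Qed.

Section sections.
Variable phi : R -> R.
Hypothesis phi0 : forall y, 0 <= y -> 0 <= phi y.
Hypothesis mphi : measurable_fun setT phi.

Let D : set (T * R) := [set: T] `*` `]0%R, 1%R[.
Let F := (fun z => (phi (K_rderiv_of z))%:E) \_ D.

Let mF : measurable_fun setT F.
Proof.
have mD : measurable D by exact: measurableX.
apply/(measurable_restrictT _ mD); apply: measurable_funTS.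
apply/measurable_EFinP; exact: (measurableT_comp mphi K_rderiv_of_measurable).
Qed.

Let F0 z : (0 <= F z)%E.
Proof.
by apply: erestrict_ge0 => y _; rewrite lee_fin phi0// K_rderiv_of_ge0.
Qed.

Let sectionE w :
  fubini_F leb F w = (\int[leb]_(s in `]0%R, 1%R[) (phi (k s (f w)))%:E)%E.
Proof.
rewrite /fubini_F.
transitivity (\int[leb]_(s in `]0%R, 1%R[) (phi (K_rderiv_of (w, s)))%:E)%E.
  rewrite [RHS]integral_mkcond; apply: eq_integral => s _; rewrite /F !patchE.
  have -> // : ((w, s) \in D) = (s \in (`]0%R, 1%R[%classic : set R)).
  by apply/idP/idP; rewrite !inE/=; [case|split].
apply: ae_eq_integral => //.
- apply: measurable_funTS; apply/measurable_EFinP.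
  apply: (measurableT_comp mphi).
  exact: (measurableT_comp K_rderiv_of_measurable (measurable_pair1 w)).
- apply/measurable_EFinP; apply: (measurableT_comp mphi).
  apply: (density_measurable k_dens) => s /=.
  by rewrite !in_itv/= andbT => /andP[].
- have [N [mN N0 sN]] := density_ae_eq (f w); exists N; split => // s h.
  apply: sN => /= h'; apply: h => /=; rewrite in_itv/= => /andP[s0 _].
  by rewrite /K_rderiv_of/= s0 h'.
Qed.

(** On each section [k] agrees almost everywhere with the derivative, so the iterated integral may
    be written with [k] itself. It is applied to the identity and to the positive part of y - l. *)
Lemma tonelli_density :
  (\int[mu \x leb]_(z in [set: T] `*` `]0%R, 1%R[) (phi (K_rderiv_of z))%:E =
   \int[mu]_w \int[leb]_(s in `]0%R, 1%R[) (phi (k s (f w)))%:E)%E.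
Proof.
rewrite integral_mkcond fubini_tonelli1//.
by apply: eq_integral => w _; exact: sectionE.
Qed.

Lemma density_section_measurable :
  measurable_fun setT (fun w => \int[leb]_(s in `]0%R,
    1%R[) (phi (k s (f w)))%:E)%E.
Proof.
apply: (eq_measurable_fun (fubini_F leb F)); first by move=> w _;
  exact: sectionE.
exact: measurable_fun_fubini_tonelli_F.
Qed.

End sections.
End ae_density.

(** * Dyadic sums *)

Section dyadic.
Context {R : realType}.
Variable alpha : R.
Hypothesis alpha_gt0 : 0 < alpha.
Implicit Types (x y M theta : R) (n N : nat).

Let q : R := 2 `^ alpha.

(** The logarithm of the n-th level is 2^n, whose power alpha is q^n, and each level is the square
    of the previous one. *)
Definition level n : R := expR (2 ^+ n).

Lemma q_gt1 : 1 < q.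
Proof. by rewrite /q /powR gt_eqF// expR_gt1 mulr_gt0// ln_gt0// ltr1n. Qed.

Lemma level_gt0 n : 0 < level n. Proof. exact: expR_gt0. Qed.

Lemma exprn_powR n : ((2 : R) ^+ n) `^ alpha = q ^+ n.
Proof. by rewrite -powR_mulrn// -powRrM mulrC powRrM powR_mulrn// powR_ge0. Qed.

Let powR_homo a b : 0 <= a -> a <= b -> a `^ alpha <= b `^ alpha.
Proof.
move=> a0 ab; apply: ge0_ler_powR => //; first exact: ltW.
exact: le_trans ab.
Qed.

Lemma sum_geometric_le N : \sum_(0 <= n < N) q ^+ n <= q ^+ N / (q - 1).
Proof.
have q1 : 0 < q - 1 by rewrite subr_gt0 q_gt1.
elim: N => [|N IH]; first by rewrite big_geq// divr_ge0// ?exprn_ge0 ?ltW//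
  powR_ge0.
rewrite big_nat_recr//=; apply: le_trans (lerD IH (lexx _)) _.
have -> // : q ^+ N / (q - 1) + q ^+ N = q ^+ N.+1 / (q - 1).
by rewrite exprS; field; rewrite gt_eqF.
Qed.

(** Only levels below x contribute, each at most q^n x. The geometric sum of these q^n is comparable
    to its last term, which is at most (ln x)^alpha. *)
Lemma sum_excess_le x N : 0 <= x ->
  \sum_(0 <= n < N) q ^+ n * Num.max (x - level n) 0 <=
  q / (q - 1) * (x * log_plus x `^ alpha).
Proof.
move=> x0; have q1 : 0 < q - 1 by rewrite subr_gt0 q_gt1.
have q0 : 0 <= q by rewrite powR_ge0.
have C0 : 0 <= q / (q - 1) by rewrite divr_ge0// ltW.
have key m : level m < x ->
    \sum_(0 <= n < m.+1) q ^+ n <= q / (q - 1) * log_plus x `^ alpha.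
  move=> mx; apply: le_trans (sum_geometric_le _) _.
  rewrite exprS mulrAC ler_wpM2l// -exprn_powR.
  have xp : 0 < x by rewrite (lt_trans (level_gt0 m)).
  have lx : 2 ^+ m <= ln x by rewrite -ler_expR lnK// ltW.
  have lp : 2 ^+ m <= log_plus x by rewrite /log_plus le_max lx.
  by apply: powR_homo.
have H : \sum_(0 <= n < N) q ^+ n * (if level n < x then 1 else 0) <=
    q / (q - 1) * log_plus x `^ alpha.
  elim: N => [|N IH]; first by rewrite big_geq// mulr_ge0// powR_ge0.
  rewrite big_nat_recr//=; case: ifPn => [Nx|_]; last by rewrite mulr0 addr0.
  apply: le_trans (key _ Nx); rewrite big_nat_recr//= mulr1 lerD2r.
  by apply: ler_sum => n _; rewrite ler_piMr ?exprn_ge0//; case: ifP.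
rewrite mulrCA; apply: le_trans (ler_wpM2l x0 H); rewrite mulr_sumr.
apply: ler_sum => n _; rewrite mulrCA ler_wpM2l ?exprn_ge0//.
case: ifPn => h; last by rewrite mulr0 ge_max lexx subr_le0 leNgt h.
by rewrite mulr1 ge_max x0 lerBlDr lerDl ltW// level_gt0.
Qed.

Lemma level_unbounded x : exists n, x < level n.
Proof.
have [n xn] : exists n : nat, x < n%:R.
  by exists (Num.truncn `|x|).+1;
    rewrite (le_lt_trans (ler_norm _))// truncnS_gt.
exists n; apply: (lt_le_trans xn).
have h1 : n%:R <= 2 ^+ n :> R by rewrite -natrX ler_nat ltnW// ltn_expl.
apply: le_trans (expR_ge1Dx _); lra.
Qed.

Lemma level_ge2 n : 2 * level n <= level n.+1.
Proof.
have -> : level n.+1 = level n * level n.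
  by rewrite /level exprS -expRD; congr expR; ring.
rewrite /level ler_wpM2r ?expR_ge0//.
have := expR_ge1Dx (2 ^+ n : R);
  have : 1 <= 2 ^+ n :> R by rewrite exprn_ege1// ler1n.
lra.
Qed.

(** One term suffices. Let m + 2 be the least index of a level above x / M. As levels at least
    double, the m-th excess is at least x / 2, while the logarithm of x is at most ln M + 2^(m+2) <=
    (ln M + 4) 2^m. This explains the constants 2 and 4. For a least index 0 or 1, the term x is
    enough. *)
Lemma log_le_sum_excess M : 1 <= M -> exists2 C, 0 <= C & forall x, 0 <= x ->
  exists N, x * log_plus x `^ alpha <=
    C * (x + \sum_(0 <= n < N) q ^+ n * Num.max (x - M * level n) 0).
Proof.
move=> M1; have M0 : 0 < M by rewrite (lt_le_trans _ M1).
have lM : 0 <= ln M by rewrite ln_ge0.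
pose C := 2 * (ln M + 4) `^ alpha.
have C0 : 0 <= C by rewrite mulr_ge0// powR_ge0.
have q0 : 0 <= q by rewrite powR_ge0.
exists C => // x x0.
have lpx0 : 0 <= log_plus x by rewrite /log_plus le_max lexx orbT.
have lp n : x < M * level n -> log_plus x <= ln M + 2 ^+ n.
  move=> xn; rewrite /log_plus ge_max addr_ge0 ?exprn_ge0// andbT.
  have [x00|xp] := leP x 0; first by rewrite ln0// addr_ge0 ?exprn_ge0.
  rewrite -[2 ^+ n]expRK -lnM ?posrE ?expR_gt0// ler_ln ?posrE ?mulr_gt0
    ?expR_gt0//.
  exact: ltW.
have ex : exists n, x < M * level n.
  have [n hn] := level_unbounded (x / M); exists n.
  by rewrite mulrC -ltr_pdivrMr.
case: (ex_minnP ex) => m xm min_m.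
case: m => [|[|m]] in xm min_m *.
- exists 0%N; rewrite big_geq// addr0 mulrC ler_wpM2r//.
  apply: (@le_trans _ _ ((ln M + 4) `^ alpha)).
    by apply: powR_homo => //; have := lp _ xm; rewrite expr0; lra.
  by rewrite /C ler_peMl ?powR_ge0// ler1n.
- exists 0%N; rewrite big_geq// addr0 mulrC ler_wpM2r//.
  apply: (@le_trans _ _ ((ln M + 4) `^ alpha));
    last by rewrite /C ler_peMl ?powR_ge0// ler1n.
  by apply: powR_homo => //; have := lp _ xm; rewrite expr1; lra.
exists m.+1.
have xm1 : M * level m.+1 <= x by rewrite leNgt; apply/negP => /min_m;
  rewrite ltnn.
have h2 : x / 2 <= x - M * level m.
  have := ler_wpM2l (ltW M0) (level_ge2 m); rewrite mulrCA; lra.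
have s0 n : 0 <= q ^+ n * Num.max (x - M * level n) 0.
  by rewrite mulr_ge0 ?exprn_ge0// le_max lexx orbT.
have h3 : q ^+ m * (x / 2) <=
    x + \sum_(0 <= n < m.+1) q ^+ n * Num.max (x - M * level n) 0.
  rewrite big_nat_recr//= addrA ler_wpDl//.
    by rewrite addr_ge0// sumr_ge0.
  by rewrite ler_wpM2l ?exprn_ge0// le_max h2.
apply: le_trans (ler_wpM2l C0 h3).
have -> : C * (q ^+ m * (x / 2)) = x * ((ln M + 4) `^ alpha * q ^+ m).
  by rewrite /C; field.
rewrite ler_wpM2l// -exprn_powR -powRM ?exprn_ge0//; last by rewrite addr_ge0.
apply: powR_homo => //; apply: le_trans (lp _ xm) _;
  rewrite mulrDl !exprS mulrA -natrM lerD2r.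
by rewrite ler_peMr// exprn_ege1// ler1n.
Qed.

(** From y / c <= exp(y / c) with c = 2 alpha. The rate 1 / 2 allows two such bounds to be
    multiplied under exp y in [sum_level_le]. *)
Lemma powR_le_expR : exists2 C, 0 < C & forall y, 0 < y -> y `^ alpha
  <= C * expR (y / 2).
Proof.
pose c := 2 * alpha; have c0 : 0 < c by rewrite mulr_gt0.
exists (c `^ alpha); first by rewrite powR_gt0.
move=> y y0; have yc : y <= c * expR (y / c).
  rewrite -ler_pdivrMl// mulrC; have := expR_ge1Dx (y / c); lra.
apply: le_trans (powR_homo (ltW y0) yc) _;
  rewrite powRM ?(ltW c0) ?expR_ge0// ler_wpM2l ?powR_ge0//.
rewrite /powR gt_eqF ?expR_gt0// expRK ler_expR /c.
by rewrite le_eqVlt; apply/orP; left; apply/eqP; field; rewrite gt_eqF.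
Qed.

(* The general term is dominated by the increment of [D / (1 + y ^ alpha)]
   between [y = 2 ^ n theta] and [y = 2 ^ n.+1 theta]. *)
Lemma sum_level_le : exists2 C, 0 <= C & forall theta N, 0 < theta < 1 ->
  \sum_(0 <= n < N) q ^+ n * level n `^ (1 - p_exp theta)
    <= C * theta `^ (- alpha).
Proof.
have [c c0 hc] := powR_le_expR.
have q1 : 0 < q - 1 by rewrite subr_gt0 q_gt1.
have q0 : 0 < q by rewrite (lt_trans _ q_gt1).
(* Chosen so that, for t = y^alpha, the increment of D / (1 + t) is t (1 + c) (1 + q c) / ((1 + t)
   (1 + q t)). *)
pose D := (1 + c) * (1 + q * c) / (q - 1).
have D0 : 0 < D by rewrite divr_gt0// mulr_gt0// addr_gt0// mulr_gt0.
have step y : 0 < y -> y `^ alpha * expR (- y) <=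
    D / (1 + y `^ alpha) - D / (1 + (2 * y) `^ alpha).
  move=> y0; rewrite powRM ?(ltW y0)// -/q.
  have := hc y y0; set t := y `^ alpha => ht.
  have t0 : 0 < t by rewrite powR_gt0.
  have e1 : 1 <= expR (y / 2) by rewrite -expR0 ler_expR divr_ge0// ltW.
  have ee : expR y = expR (y / 2) * expR (y / 2) by rewrite -expRD -splitr.
  have -> : D / (1 + t) - D / (1 + q * t) = t * ((1 + c) * (1 + q * c) / ((1
    + t) * (1 + q * t))).
    rewrite /D; field; rewrite !gt_eqF//; rewrite addr_gt0// mulr_gt0//.
  rewrite ler_wpM2l ?(ltW t0)// expRN ler_pdivlMr; last first.
    by rewrite mulr_gt0 ?addr_gt0 ?mulr_gt0.
  rewrite mulrC ler_pdivrMr ?expR_gt0// ee.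
  have -> : (1 + c) * (1 + q * c) * (expR (y / 2) * expR (y / 2)) =
    ((1 + c) * expR (y / 2)) * ((1 + q * c) * expR (y / 2)) by ring.
  apply: ler_pM; rewrite ?addr_ge0 ?mulr_ge0 ?(ltW q0) ?(ltW t0)//.
    by rewrite mulrDl mul1r lerD.
  by rewrite mulrDl mul1r lerD// -mulrA ler_wpM2l ?(ltW q0).
exists D; first exact: ltW.
move=> theta N t01; have /andP[t0 t1] := t01.
have tp : 0 < theta `^ alpha by rewrite powR_gt0.
rewrite powRN ler_pdivlMr// mulr_suml.
have h n : q ^+ n * level n `^ (1 - p_exp theta) * theta `^ alpha <=
    D / (1 + (2 ^+ n * theta) `^ alpha) - D / (1
      + (2 ^+ n.+1 * theta) `^ alpha).
  have y0 : 0 < 2 ^+ n * theta by rewrite mulr_gt0// exprn_gt0.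
  have -> : 2 ^+ n.+1 * theta = 2 * (2 ^+ n * theta) by rewrite exprS mulrA.
  apply: le_trans (step _ y0).
  rewrite mulrAC powRM ?exprn_ge0 ?(ltW t0)// exprn_powR.
  rewrite ler_wpM2l ?mulr_ge0 ?exprn_ge0 ?(ltW q0) ?(ltW tp)//.
  (* As p - 1 = theta / (1 - theta) >= theta, the power of the level is at most exp(- 2^n theta). *)
  rewrite /level /powR gt_eqF ?expR_gt0// expRK ler_expR -opprB mulNr lerN2
    [leRHS]mulrC.
  rewrite ler_wpM2l ?exprn_ge0// /p_exp lerBrDr -[leRHS]mul1r ler_pdivlMr
    ?subr_gt0//.
  by nra.
apply: (@le_trans _ _ (\sum_(0
  <= n < N) (D / (1 + (2 ^+ n * theta) `^ alpha) - D / (1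
    + (2 ^+ n.+1 * theta) `^ alpha)))).
  by apply: ler_sum => n _; exact: h.
pose W n := D / (1 + (2 ^+ n * theta) `^ alpha).
have W0 n : 0 <= W n by rewrite divr_ge0 ?(ltW D0)// addr_ge0// powR_ge0.
have -> : \sum_(0 <= n < N) (W n - W n.+1) = W 0%N - W N.
  elim: N => [|N IH]; first by rewrite big_geq// subrr.
  by rewrite big_nat_recr//= IH addrA subrK.
have h0 : W 0%N <= D.
  rewrite /W ler_pdivrMr; last by rewrite ltr_wpDr// powR_ge0.
  by rewrite ler_peMr ?(ltW D0)// lerDl powR_ge0.
by have := W0 N; lra.
Qed.

(** Weighted arithmetic-geometric inequality for X^(1 - theta) Y^theta, with both weights bounded by
    1. It makes a fractional power of an L1 norm linear. *)
Lemma young_le X Y theta : 0 <= X -> 0 < Y -> 0 < theta < 1 ->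
  X `^ (1 - theta) <= Y `^ (- theta) * (X + Y).
Proof.
move=> X0 Y0 /andP[t0 t1]; have s0 : 0 < 1 - theta by rewrite subr_gt0.
rewrite powRN ler_pdivlMl ?powR_gt0// mulrC.
have i1 : 0 < (1 - theta)^-1 by rewrite invr_gt0.
have i2 : 0 < theta^-1 by rewrite invr_gt0.
have := conjugate_powR (powR_ge0 X (1 - theta)) (powR_ge0 Y theta) i1 i2.
rewrite !invrK subrK => /(_ erefl);
  rewrite -!powRrM !mulfV ?gt_eqF// !powRr1 ?(ltW Y0)//.
move=> h; apply: le_trans h _; apply: lerD.
  by rewrite ler_piMr//; lra.
by rewrite ler_piMr ?(ltW Y0)//; lra.
Qed.

(** The n-th level to the power [theta_ n] is exp(1 / 2); the shift by one keeps [theta_ 0] below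
    1. *)
Definition theta_ n : R := (2 ^+ n.+1)^-1.

Lemma theta_01 n : 0 < theta_ n < 1.
Proof.
rewrite invr_gt0 exprn_gt0//= invf_lt1 ?exprn_gt0//.
by rewrite exprn_egt1// ltr1n.
Qed.

Lemma theta_powRN n : theta_ n `^ (- alpha) = q ^+ n.+1.
Proof.
by rewrite /theta_ -exprn_powR -powR_inv1 ?exprn_ge0// -powRrM mulrN mulN1r
  opprK.
Qed.

(** [young_le] with Y = (2 q)^(-n): the factor Y^(- theta) is at most 2 q because n [theta_ n] <= 1,
    and q^n Y = 2^(-n) remains summable. *)
Lemma level_powR_theta n X : 0 <= X ->
  (4 * level n) `^ theta_ n * X `^ (1 - theta_ n) <=
  4 * expR 1 * (2 * q) * (X + ((2 * q) ^+ n)^-1).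
Proof.
move=> X0; have t01 := theta_01 n; have /andP[t0 t1] := t01.
have q0 : 0 < q by rewrite (lt_trans _ q_gt1).
have q2 : 1 <= 2 * q by have := q_gt1; lra.
have q20 : 0 < 2 * q by rewrite mulr_gt0.
have qn : 0 < (2 * q) ^+ n by rewrite exprn_gt0.
rewrite -mulrA; apply: ler_pM; rewrite ?powR_ge0//.
  rewrite powRM ?expR_ge0// ; apply: ler_pM; rewrite ?powR_ge0//.
    by rewrite -[leRHS]powRr1// ler_powR ?(ltW t1)// ler1n.
  rewrite /powR gt_eqF ?expR_gt0// expRK ler_expR /theta_ exprS.
  by rewrite invfM -mulrA mulVf ?gt_eqF ?exprn_gt0//; lra.
have Y0 : 0 < ((2 * q) ^+ n)^-1 by rewrite invr_gt0.
apply: le_trans (young_le X0 Y0 t01) _.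
rewrite ler_wpM2r ?addr_ge0 ?(ltW Y0)//.
rewrite -(powR_invn _ (ltW q20)) -powRrM mulrNN -[leRHS](powRr1 (ltW q20)).
apply: ler_powR => //; rewrite ler_pdivrMr ?exprn_gt0// mul1r -natrX ler_nat.
by rewrite ltnW// (ltn_trans (ltnSn n))// ltn_expl.
Qed.

End dyadic.

(** * Bochner norms *)

Section bochner_spaces.
Context {R : realType} d (T : measurableType d).
Variable mu : {finite_measure set T -> \bar R}.
Local Open Scope ereal_scope.

Section general.
Context {V : zmodType}.
Implicit Types (N : V -> \bar R) (f : T -> V).

Lemma bochner_norm_ge0 N p f : 0 <= bochner_norm mu N p f.
Proof. by rewrite /bochner_norm; case: asboolP => _;
  [exact: Lnorm_ge0|exact: leey]. Qed.

Lemma bochner_norm_lty N p f : bochner_norm mu N p f < +oo ->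
  strongly_measurable mu N f /\ bochner_norm mu N p f = 'N[mu]_p[N \o f].
Proof. by rewrite /bochner_norm; case: asboolP. Qed.

Lemma bochner_norm0 N p : N 0%R = 0 -> p != 0 ->
  bochner_norm mu N p (fun=> 0%R) = 0.
Proof.
move=> N0 p0; rewrite /bochner_norm asboolT.
  by rewrite -(Lnorm0 mu p0); apply: eq_Lnorm => w /=.
exists (fun _ => fun=> 0%R); last first.
  by apply: nearW => w; rewrite subrr N0; exact: cvg_cst.
move=> n; have [h1 h2] := simple_map_cst T (0%R : V).
by split => // w; rewrite N0 ltry.
Qed.

(* The simple functions are eventually equal to [c], not just close to it, so
   they converge to [c] in every norm that is finite on the range of [c]. *)
Definition eventually_simple {X : Type} (c : T -> X) := exists2 s : nat -> T ->
  X,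
  (forall n, simple_map (s n)) & (forall w, \forall n \near \oo, s n w = c w).

Lemma strongly_measurable_eventually_simple N f : N 0%R = 0 ->
  (forall w, N (f w) < +oo) -> eventually_simple f -> strongly_measurable mu N
    f.
Proof.
move=> N0 Nf [s ss sf].
(* Approximants of infinite norm are replaced by 0; at each point this stops happening once they
   equal [f w]. *)
pose t n w := if `[< N (s n w) < +oo >] then s n w else 0%R.
exists t.
  move=> n; have [h1 h2] := simple_map_comp (fun x =>
    if `[< N x < +oo >] then x else 0%R) (ss n).
  by split => // w; rewrite /t; case: asboolP => //; rewrite N0 ltry.
apply: nearW => w; apply: cvg_near_cst.
apply: filterS (sf w) => n sn; rewrite /t sn asboolT//.
by rewrite subrr N0.
Qed.

End general.

Lemma eventually_simple_comp X Y (F : X -> Y) (c : T -> X) :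
  eventually_simple c -> eventually_simple (F \o c).
Proof.
move=> [s ss sc]; exists (fun n => F \o s n).
  by move=> n; exact: simple_map_comp.
by move=> w; apply: filterS (sc w) => n /= ->.
Qed.

Lemma eventually_simple_pair X Y (c : T -> X) (e : T -> Y) :
  eventually_simple c -> eventually_simple e -> eventually_simple (fun w =>
    (c w, e w)).
Proof.
move=> [s ss sc] [t st te]; exists (fun n w => (s n w, t n w)).
  by move=> n; exact: simple_map_pair.
by move=> w; apply: filterS2 (sc w) (te w) => n -> ->.
Qed.

Lemma eventually_simple_limit (V : normedModType R) (c : T -> V) :
  eventually_simple c -> simple_limit c.
Proof.
move=> [s ss sc]; exists s => // w; apply: cvg_near_cst; exact: sc.
Qed.

Section L1_Loo.
Context {A0 A1 : completeNormedModType R}.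
Variable j : {linear A1 -> A0}.
Hypothesis j_le : forall a, (`|j a| <= `|a|)%R.
Implicit Types g : T -> A0.

Lemma norm_le_norm1 x : `|x|%:E <= norm1 j x.
Proof. by apply: le_ereal_inf_tmp => _ [a /= <- <-]; rewrite lee_fin. Qed.

Lemma norm1_image a : norm1 j (j a) <= `|a|%:E.
Proof. by apply: ereal_inf_lbound; exists a. Qed.

Lemma norm1_0 : norm1 j 0%R = 0.
Proof.
apply/eqP; rewrite eq_le -[X in norm1 j X](linear0 j).
rewrite (le_trans (norm1_image _)) ?normr0//=.
by rewrite linear0 (le_trans _ (norm_le_norm1 _))// normr0.
Qed.

Lemma ae_le_Lnorm_oo (F : T -> \bar R) : (forall w, 0 <= F w) ->
  {ae mu, forall w, F w <= 'N[mu]_+oo[F]}.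
Proof.
move=> F0; rewrite unlock /Lnorm; case: ifPn => [_|].
  apply: filterS (ess_sup_ge mu (abse \o F)) => w /=.
  by rewrite gee0_abs.
(* If the whole space is null, anything holds almost everywhere. *)
rewrite -leNgt => muT; exists setT; split => //.
by apply/eqP; rewrite eq_le muT measure_ge0.
Qed.

(** On a finite measure space the bounded A1-valued part is integrable in A0. With [L1_Loo_norm_le],
    the ambient sum space is L1 with values in A0, up to equivalence of norms. *)
Lemma L1_Loo_norm_bound (e : R) g : L1_Loo_norm mu j g < e%:E ->
  strongly_measurable mu norm0 g /\
  \int[mu]_w `|g w|%:E <= e%:E * (1 + mu setT).
Proof.
move=> /ereal_inf_lt[_ [y _ <-]].
set b0 := bochner_norm _ _ _ _; set b1 := bochner_norm _ _ _ _ => he.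
have b00 : 0 <= b0 by exact: bochner_norm_ge0.
have b10 : 0 <= b1 by exact: bochner_norm_ge0.
have b0e : b0 <= e%:E by rewrite (le_trans _ (ltW he))// leeDl.
have b1e : b1 <= e%:E by rewrite (le_trans _ (ltW he))// leeDr.
have [sy yE] := bochner_norm_lty (le_lt_trans b0e (ltry _)).
have [sz zE] := bochner_norm_lty (le_lt_trans b1e (ltry _)).
have [y' ly yy'] := strongly_measurable_rep (fun x => lexx _) sy.
have [z' lz zz'] := strongly_measurable_rep norm_le_norm1 sz.
have gE : {ae mu, forall w, g w = (y' w + z' w)%R}.
  apply: filterS2 yy' zz' => w <- <-.
  by rewrite [RHS](_ : _ = y w + (g w - y w))%R// addrC subrK.
have bz : {ae mu, forall w, `|z' w|%:E <= b1}.
  apply: filterS2 zz' (ae_le_Lnorm_oo (F := norm1 j \o (g - y)%R) _).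
    by move=> w <- h; rewrite /b1 zE (le_trans _ h)//= norm_le_norm1.
  by move=> w /=; rewrite (le_trans _ (norm_le_norm1 _)).
split.
  by apply: strongly_measurable_simple_limit gE; exact: simple_limitD.
have my : measurable_fun setT (fun w => `|y' w|%:E).
  by apply/measurable_EFinP; exact: simple_limit_norm.
apply: (@le_trans _ _ (\int[mu]_w (`|y' w|%:E + cst b1 w))).
  apply: ae_ge0_le_integralT => //.
    by move=> w; rewrite adde_ge0.
  apply: filterS2 gE bz => w -> h.
  by rewrite (le_trans _ (leeD2l _ h))// -EFinD lee_fin ler_normD.
rewrite ge0_integralD// integral_cst//.
have -> : \int[mu]_w `|y' w|%:E = b0.
  rewrite /b0 yE Lnorm1; apply: ae_eq_integralT => //.
  by apply: filterS yy' => w /= ->; rewrite normr_id.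
have e0 : (0 <= e)%R by rewrite -lee_fin (le_trans b00).
rewrite ge0_muleDr// mule1 leeD// lee_wpmul2r//.
Qed.

Lemma L1_Loo_norm_le g : strongly_measurable mu norm0 g ->
  L1_Loo_norm mu j g <= \int[mu]_w `|g w|%:E.
Proof.
move=> sg; apply: ereal_inf_le; eexists; first by exists g.
rewrite (_ : (g - g)%R = (fun=> 0%R)); last by rewrite subrr.
rewrite bochner_norm0 ?norm1_0// adde0 /bochner_norm asboolT// Lnorm1.
by apply: ge0_le_integralT => // w; rewrite /= normr_id.
Qed.

End L1_Loo.
End bochner_spaces.

(** * Sums over families of interpolation spaces *)

Section necessity.
Context {R : realType} d (T : measurableType d).
Variable mu : {finite_measure set T -> \bar R}.
Context {A0 A1 : completeNormedModType R}.
Notation leb := (@lebesgue_measure R).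
Variable j : {linear A1 -> A0}.
Variable k : R -> A0 -> R.
Hypothesis k_dens : is_K_density j k.
Hypothesis j_le : forall a, `|j a| <= `|a|.
Local Notation interpX theta x :=
  (interp_norm j theta (p_exp theta) x `^ p_exp theta)%E.

(** The i-th term is charged the share c_i l of the slope l. The shares add up to at most l, so
    their contribution is absorbed by l r in [K_excess_le]. *)
Lemma K_excess_sum_le (I : finType) (theta c : I -> R) (a : I -> A0) (g : A0) l
  :
  0 < l -> (forall i, 0 < theta i < 1) -> (forall i, 0 < c i) -> \sum_i c i
    <= 1 ->
  (K_excess k l (g + \sum_i a i)%R <= `|g|%:E +
    \sum_i ((c i * l) `^ (1 - p_exp (theta i)))%:E * interpX (theta i) (a i))%E.
Proof.
move=> l0 t01 c0 c1.
have s0 : (0 <= \sum_i ((c i * l) `^ (1 - p_exp (theta i)))%:E * interpX (theta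
  i) (a i))%E.
  by apply: sume_ge0 => i _; rewrite mule_ge0 ?poweR_ge0// lee_fin powR_ge0.
apply: (K_excess_le k_dens); first exact: ltW.
  by rewrite adde_ge0.
move=> r r0.
apply: (@le_trans _ _ (`|g|%:E + \sum_i (K j r (a i))%:E)%E).
  rewrite sumEFin -EFinD lee_fin; apply: le_trans (K_triangle _ _ _ (ltW r0)) _.
  by apply: lerD; [exact: K_le_norm (ltW r0)|exact: K_sum (ltW r0)].
rewrite -addeA leeD2l//.
apply: (@le_trans _ _ (\sum_i (((c i * l) `^ (1 - p_exp (theta i)))%:E *
  interpX (theta i) (a i)
   + (c i * l * r)%:E))%E).
  apply: lee_sum => i _; rewrite addeC.
  by apply: K_excess_le_interp => //; rewrite mulr_gt0.
rewrite big_split/= leeD2l// sumEFin lee_fin -mulr_suml -mulr_suml.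
by rewrite ler_wpM2r ?(ltW r0)// ler_piMl ?(ltW l0).
Qed.

(** Integrates [K_excess_sum_le], after replacing each function by an everywhere limit of simple
    maps, for which the integrand is measurable and the integral can be split. *)
Lemma integral_K_excess_le (I : finType) (theta c x : I -> R)
    (a : I -> T -> A0) (f f' g : T -> A0) l :
  0 < l -> (forall i, 0 < theta i < 1) -> (forall i, 0 < c i) -> \sum_i c i
    <= 1 ->
  simple_limit f' -> {ae mu, forall w, f w = f' w} ->
  strongly_measurable mu norm0 g ->
  (forall w, f w = g w + \sum_i a i w) ->
  (forall i, bochner_norm mu (interp_norm j (theta i) (p_exp (theta i)))
     (p_exp (theta i))%:E (a i) = (x i)%:E) ->
  (\int[mu]_w K_excess k l (f' w) <= \int[mu]_w `|g w|%:E +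
     (\sum_i (c i * l) `^ (1 - p_exp (theta i)) * x i `^ p_exp (theta i))%:E)%E.
Proof.
move=> l0 t01 c0 c1 sf' ff' sg fE xE.
have p0 i : p_exp (theta i) != 0
  by rewrite gt_eqF// (lt_trans _ (p_exp_gt1 (t01 i))).
have bi i := bochner_norm_lty (eq_ind_r (fun y =>
  (y < +oo)%E) (ltry (x i)) (xE i)).
have rep i : exists a', simple_limit a' /\ {ae mu, forall w, a i w = a' w}.
  have [sa _] := bi i.
  have [a' h1 h2] := strongly_measurable_rep (fun y =>
    norm_le_interp j_le y (t01 i)) sa.
  by exists a'.
have [a' ha'] := choice rep.
have [g' sg' gg'] := strongly_measurable_rep (fun x => lexx _) sg.
pose H i w := (((c i * l) `^ (1 - p_exp (theta i)))%:E * interpX (theta i) (a'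
  i w))%E.
have H0 i w : (0 <= H i w)%E by rewrite mule_ge0 ?poweR_ge0// lee_fin powR_ge0.
have mH i : measurable_fun setT (H i).
  apply: measurable_funeM; apply: interp_normX_measurable => //.
  by have [] := ha' i.
have mg' : measurable_fun setT (fun w => `|g' w|%:E).
  by apply/measurable_EFinP; exact: simple_limit_norm.
apply: (@le_trans _ _ (\int[mu]_w (`|g' w|%:E + \sum_i H i w))%E).
  apply: ae_ge0_le_integralT.
  - by move=> w; exact: excess_ge0.
  - by move=> w; rewrite adde_ge0// sume_ge0.
  have aeA : {ae mu, forall w, forall i, a i w = a' i w}.
    by apply: filter_forall => i; have [] := ha' i.
  near=> w; have E1 : f w = f' w by near: w.
  have E2 : g w = g' w by near: w.
  have E3 : forall i, a i w = a' i w by near: w.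
  rewrite -E1 fE E2; under eq_bigr do rewrite E3.
  exact: K_excess_sum_le.
rewrite ge0_integralD//; last 2 first.
- by move=> w _; rewrite sume_ge0.
- exact: emeasurable_sum.
rewrite ge0_integral_sum// leeD//.
  rewrite (@ae_eq_integralT _ _ _ _ (fun w => `|g' w|%:E) (fun w =>
    `|g w|%:E))//.
  by apply: filterS gg' => w ->.
rewrite -sumEFin; apply: lee_sum => i _.
rewrite ge0_integralZl_EFin ?powR_ge0//; last 2 first.
- by move=> w _; exact: poweR_ge0.
- by apply: interp_normX_measurable => //; have [] := ha' i.
rewrite EFinM lee_wpmul2l ?lee_fin ?powR_ge0// -poweR_EFin -xE (bi i).2
  poweR_Lnorm//.
apply: ae_ge0_le_integralT => //.
- by move=> w; exact: poweR_ge0.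
- by move=> w; exact: poweR_ge0.
have [_ h] := ha' i; apply: filterS h => w <- /=.
by rewrite gee0_abs// interp_norm_ge0.
Unshelve. all: by end_near. Qed.

End necessity.

(** * The Zygmund class and dyadic sums of excesses *)

Section zygmund_excess.
Context {R : realType} d (T : measurableType d).
Variable mu : {finite_measure set T -> \bar R}.
Context {A0 A1 : completeNormedModType R}.
Notation leb := (@lebesgue_measure R).
Variable j : {linear A1 -> A0}.
Variable k : R -> A0 -> R.
Hypothesis k_dens : is_K_density j k.
Hypothesis j_le : forall a, `|j a| <= `|a|.
Variable alpha : R.
Hypothesis alpha_gt0 : 0 < alpha.
Variables f f' : T -> A0.
Hypothesis sf' : simple_limit f'.
Hypothesis ff' : {ae mu, forall w, f w = f' w}.

Let q : R := 2 `^ alpha.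
Let G := K_rderiv_of j f'.
Let D : set (T * R) := [set: T] `*` `]0%R, 1%R[.

Let mD : measurable D. Proof. exact: measurableX. Qed.
Let mG : measurable_fun setT G.
Proof. exact (K_rderiv_of_measurable k_dens j_le sf'). Qed.
Let G0 z : 0 <= G z. Proof. exact: K_rderiv_of_ge0 k_dens f' z. Qed.
Let q0 : 0 <= q. Proof. exact: powR_ge0. Qed.

(** A null set of points times the line is null in the product, so [f] may be replaced by [f']. *)
Lemma density_rep_ae_eq :
  {ae (mu \x leb)%E, forall z, D z -> k z.2 (f z.1) = K_rderiv_of j f' z}.
Proof.
have h1 : {ae (mu \x leb)%E, forall z : T * R, f z.1 = f' z.1}.
  have [N [mN N0 sN]] := ff'; exists (N `*` setT); split.
  - exact: measurableX.
  - transitivity (mu N * leb setT)%E; last by rewrite N0 mul0e.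
    exact: product_measure1E.
  - by move=> z /= h; split => //; exact: sN.
have h2 := density_joint_ae_eq mu k_dens j_le sf'.
apply: (@ae_impl2 _ _ _ (mu \x leb)%E _ _ _ _ h1 h2) => z {}h1 {}h2 [_ /=];
  rewrite in_itv/= => /andP[z0 _].
by rewrite h1 h2.
Qed.

Lemma integral_K_rderiv_of : (\int[mu \x leb]_(z in D) (G z)%:E = \int[mu]_w
  `|f' w|%:E)%E.
Proof.
rewrite (@tonelli_density _ _ _ mu _ _ _ _ k_dens j_le _ sf' id)//.
apply: eq_integral => w _; have [_ _ h] := k_dens (f' w).
by rewrite h// K_norm.
Qed.

Lemma integral_K_excess_of l :
  (\int[mu \x leb]_(z in D) (Num.max (G z - l) 0)%:E = \int[mu]_w K_excess k l
    (f' w))%E.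
Proof.
rewrite (@tonelli_density _ _ _ mu _ _ _ _ k_dens j_le _ sf' (fun y =>
  Num.max (y - l) 0))//.
  by move=> y _; rewrite le_max lexx orbT.
by apply: measurable_maxr => //; apply: measurable_funB.
Qed.

Let m_excess l : measurable_fun D (fun z => (Num.max (G z - l) 0)%:E).
Proof.
apply/measurable_EFinP; apply: measurable_funTS.
by apply: measurable_maxr => //; apply: measurable_funB.
Qed.

Let max0 (y : R) : 0 <= Num.max y 0. Proof. by rewrite le_max lexx orbT. Qed.

Let integral_excessZ n l :
  (\int[mu \x leb]_(z in D) ((q ^+ n)%:E * (Num.max (G z - l) 0)%:E) =
   (q ^+ n)%:E * \int[mu]_w K_excess k l (f' w))%E.
Proof.
rewrite -integral_K_excess_of; apply: ge0_integralZl_EFin => //.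
  by move=> z _; rewrite lee_fin.
  exact: m_excess.
exact: exprn_ge0.
Qed.

Lemma measurable_log_plus : measurable_fun setT (@log_plus R).
Proof. by apply: measurable_maxr => //; exact: measurable_ln. Qed.

(** The measurable version asked for by [zygmund] is [G]. The number of terms in [log_le_sum_excess]
    depends on the point, so the whole series is integrated term by term. *)
Lemma zygmund_excess_bounded (M B : R) : 1 <= M ->
  (\int[mu]_w `|f' w|%:E < +oo)%E ->
  (forall N, (\sum_(0 <= n < N) (q ^+ n)%:E *
     \int[mu]_w K_excess k (M * level n) (f' w) <= B%:E)%E) ->
  zygmund (mu \x leb)%E D alpha (fun z => k z.2 (f z.1)).
Proof.
move=> M1 if' hB; exists G; split.
- exact: measurable_funTS.
- exact: density_rep_ae_eq.
- by under eq_integral do rewrite ger0_norm//; rewrite integral_K_rderiv_of.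
under eq_integral do rewrite ger0_norm//.
have [C C0 hC] := log_le_sum_excess alpha_gt0 M1.
pose u n z := (q ^+ n * Num.max (G z - M * level n) 0)%:E.
have u0 n z : (0 <= u n z)%E by rewrite lee_fin mulr_ge0 ?exprn_ge0.
have mu_ n : measurable_fun D (u n).
  by rewrite /u; under eq_fun do rewrite EFinM; exact: measurable_funeM.
have ms : measurable_fun D (fun z => \sum_(n <oo) u n z)%E.
  by apply: ge0_emeasurable_sum => // n z _ _.
have s0 z : (0 <= \sum_(n <oo) u n z)%E by exact: nneseries_ge0.
have mGD : measurable_fun D (fun z => (G z)%:E).
  by apply/measurable_EFinP; exact: measurable_funTS.
apply: (@le_lt_trans _ _ (\int[mu \x leb]_(z in D) (C%:E * ((G z)%:E
  + \sum_(n <oo) u n z)))%E).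
  apply: ge0_le_integral => //.
  - by move=> z _; rewrite lee_fin mulr_ge0// powR_ge0.
  - apply/measurable_EFinP; apply: measurable_funTS;
    apply: measurable_funM => //.
    apply: (measurableT_comp (measurable_powR _)).
    exact: (measurableT_comp measurable_log_plus).
  - by apply: measurable_funeM; exact: emeasurable_funD.
  move=> z _; have [N hN] := hC (G z) (G0 z).
  apply: (@le_trans _ _ (C%:E * ((G z)%:E + \sum_(0 <= n < N) u n z))%E).
    by rewrite sumEFin -EFinD -EFinM lee_fin.
  rewrite lee_wpmul2l// leeD2l//; exact: nneseries_lim_ge.
rewrite ge0_integralZl_EFin//; last 2 first.
- by move=> z _; rewrite adde_ge0// lee_fin.
- exact: emeasurable_funD.
rewrite lte_mul_pinfty// ge0_integralD//.
rewrite lte_add_pinfty//; first by rewrite integral_K_rderiv_of.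
rewrite integral_nneseries//.
apply: le_lt_trans (ltry B); apply: lime_le.
  by apply: is_cvg_nneseries => n _ _; exact: integral_ge0.
apply: nearW => N; apply: le_trans (hB N); apply: lee_sum => n _.
rewrite /u; under eq_integral do rewrite EFinM.
by rewrite integral_excessZ.
by move=> z _; rewrite lee_fin.
Qed.

Lemma excess_bounded_zygmund :
  zygmund (mu \x leb)%E D alpha (fun z => k z.2 (f z.1)) ->
  exists B : R, forall N, (\sum_(0 <= n < N) (q ^+ n)%:E *
     \int[mu]_w K_excess k (level n) (f' w) <= B%:E)%E.
Proof.
move=> [h [mh gh _ ih]].
(* [h] is an unspecified version of the density; almost everywhere on [D] it is [G], to which
   Tonelli applies. *)
have Gh : ae_eq (mu \x leb)%E D h G.
  apply: (@ae_impl2 _ _ _ (mu \x leb)%E _ _ _ _ gh density_rep_ae_eq) =>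
    z h1 h2 Dz.
  by rewrite -h1// h2.
have q1 : 0 < q - 1 by rewrite subr_gt0 q_gt1.
pose P (y : R) := `|y| * log_plus `|y| `^ alpha.
have mP : measurable_fun setT P.
  apply: measurable_funM => //; apply: (measurableT_comp (measurable_powR _)).
  by apply: (measurableT_comp measurable_log_plus).
have P0 y : 0 <= P y by rewrite mulr_ge0// powR_ge0.
have mPG : measurable_fun D (fun z => (P (G z))%:E).
  by apply/measurable_EFinP; apply: measurable_funTS;
    exact: (measurableT_comp mP).
have mPh : measurable_fun D (fun z => (P (h z))%:E).
  by apply/measurable_EFinP; exact: (measurableT_comp mP).
have iG : (\int[mu \x leb]_(z in D) (P (G z))%:E < +oo)%E.
  have -> : (\int[mu \x leb]_(z in D) (P (G z))%:E =
      \int[mu \x leb]_(z in D) (P (h z))%:E)%E; last exact: ih.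
  apply: (@ae_eq_integral _ _ _ (mu \x leb)%E D (fun z =>
    (P (h z))%:E) (fun z => (P (G z))%:E) mD mPG mPh).
  have [N [mN N0 sN]] := Gh; exists N; split => // z /= hz; apply: sN => /= hG.
  by apply: hz => Dz; rewrite hG.
set c := q / (q - 1).
have c0 : 0 <= c by rewrite divr_ge0// ltW.
exists (fine (c%:E * \int[mu \x leb]_(z in D) (P (G z))%:E)%E) => N.
have i0 : (0 <= \int[mu \x leb]_(z in D) (P (G z))%:E)%E.
  by apply: integral_ge0 => z _; rewrite lee_fin.
rewrite fineK; last by rewrite fin_numM// ge0_fin_numE.
under eq_bigr do rewrite -integral_excessZ.
rewrite -ge0_integralZl_EFin//; last by move=> z _; rewrite lee_fin.
rewrite -ge0_integral_sum//; last 2 first.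
- by move=> n; apply: measurable_funeM; exact: m_excess.
- by move=> n z _; rewrite mule_ge0// lee_fin ?exprn_ge0.
apply: ge0_le_integral => //.
- by move=> z _; rewrite sume_ge0// => n _;
  rewrite mule_ge0// lee_fin ?exprn_ge0.
- by apply: emeasurable_sum => n; apply: measurable_funeM; exact: m_excess.
- exact: measurable_funeM.
move=> z _; under eq_bigr do rewrite -EFinM.
rewrite sumEFin -EFinM lee_fin /P ger0_norm//.
exact: (sum_excess_le alpha_gt0).
Qed.

End zygmund_excess.

From mathcomp Require Import summability finmap.

(** * Dyadic excess bounds for the sum of a family *)

Section family_sums.
Context {R : realType} d (T : measurableType d).
Variable mu : {finite_measure set T -> \bar R}.
Context {A0 A1 : completeNormedModType R}.
Notation leb := (@lebesgue_measure R).
Variable j : {linear A1 -> A0}.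
Variable k : R -> A0 -> R.
Hypothesis k_dens : is_K_density j k.
Hypothesis j_le : forall a, `|j a| <= `|a|.
Variable alpha : R.
Hypothesis alpha_gt0 : 0 < alpha.

Local Notation bnorm theta :=
  (bochner_norm mu (interp_norm j (val theta) (p_exp (val theta)))
    (p_exp (val theta))%:E).

(** The left side is x (x / y)^(p - 1). This is how p-th powers of norms become norms. *)
Lemma powR_shift_le (x y p : R) : 1 < p -> 0 <= x -> x <= y -> 0 < y ->
  y `^ (1 - p) * x `^ p <= x.
Proof.
move=> p1 x0 xy y0; rewrite -(mulr_powRB1 x0 (lt_trans ltr01 p1)) -opprB powRN.
rewrite mulrCA ler_piMr// mulrC ler_pdivrMr ?powR_gt0// mul1r.
by apply: ge0_ler_powR; rewrite ?nnegrE ?subr_ge0 ?(ltW p1)// (le_trans x0).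
Qed.

Lemma sum_K_excess_bounded (a : unit_open R -> T -> A0) (f f' : T -> A0) (M :
  R) :
  0 <= M -> is_family_sum (L1_Loo_norm mu j) a f ->
  (forall F : {fset unit_open R},
    (\sum_(i : F) scaled_norm (val (val i) `^ (- alpha)) (bnorm (val i)) (a
      (val i))
      <= M%:E)%E) ->
  simple_limit f' -> {ae mu, forall w, f w = f' w} ->
  exists B : R, forall N,
   (\sum_(0 <= n < N) ((2 `^ alpha) ^+ n)%:E *
     \int[mu]_w K_excess k ((M + 1) * level n) (f' w) <= B%:E)%E.
Proof.
move=> M0 fam hM sf' ff'.
have [C C0 hC] := sum_level_le alpha_gt0.
exists (1 + C * M) => N.
set q := 2 `^ alpha; have q0 : 0 <= q by rewrite powR_ge0.
pose S := \sum_(0 <= n < N) q ^+ n.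
have S0 : 0 <= S by apply: sumr_ge0 => n _; rewrite exprn_ge0.
pose m := fine (mu setT); have m0 : 0 <= m by rewrite fine_ge0.
have mE : mu setT = m%:E by rewrite fineK// fin_num_measure.
have m1 : 0 < 1 + m by rewrite ltr_wpDr.
have S1 : 0 < S + 1 by rewrite ltr_wpDl.
have d1 : 0 < (1 + m) * (S + 1) by rewrite mulr_gt0.
(* The remainder [g] will then have L1 norm at most 1 / (S + 1), hence total weight at most 1 over
   the N levels. The finite set [F] depends on N, the final bound does not. *)
pose dl := ((1 + m) * (S + 1))^-1.
have dl0 : 0 < dl by rewrite invr_gt0.
have [F hF] : exists F : {fset unit_open R},
    (L1_Loo_norm mu j (f - partial_sum a F)%R < dl%:E)%E.
  have n0 : nbhs (0%E : \bar R) [set y | (y < dl%:E)%E].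
    by apply: open_nbhs_nbhs; split;
      [exact: open_ereal_lt_ereal|rewrite /= lte_fin].
  have [F _ h] := fam _ n0.
  by exists F; apply: (h F) => /=; exact: fsubset_refl.
set g := (f - partial_sum a F)%R in hF.
have [sg ig] := L1_Loo_norm_bound j_le hF.
pose theta (i : F) : R := val (val i).
have t01 i : 0 < theta i < 1 by exact: valP (val i).
have ta i : 0 < theta i `^ (- alpha) by rewrite powR_gt0//; case/andP: (t01 i).
pose x (i : F) := fine (bnorm (val i) (a (val i))).
have x0 i : 0 <= x i by rewrite fine_ge0// bochner_norm_ge0.
have xE i : bnorm (val i) (a (val i)) = (x i)%:E.
  rewrite fineK// ge0_fin_numE ?bochner_norm_ge0//.
  rewrite -(@lte_pmul2l _ (theta i `^ (- alpha))%:E) ?lte_fin// gt0_muley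
    ?lte_fin//.
  apply: le_lt_trans (ltry M); apply: le_trans (hM F).
  rewrite (bigD1 i)//= leeDl// sume_ge0// => i' _.
  by rewrite mule_ge0 ?bochner_norm_ge0// lee_fin powR_ge0.
have hx : \sum_i theta i `^ (- alpha) * x i <= M.
  rewrite -lee_fin -sumEFin; apply: le_trans (hM F); apply: lee_sum => i _.
  by rewrite /scaled_norm xE EFinM.
(* The added 1 / #F keeps [y i] positive when the norm vanishes, and raises the total by at most 1,
   hence the normalization by M + 1. *)
pose y (i : F) := theta i `^ (- alpha) * x i + #|{: F}|%:R^-1.
have cF (i : F) : 0 < #|{: F}|%:R^-1 :> R.
  by rewrite invr_gt0 ltr0n; apply/card_gt0P; exists i.
have y0 i : 0 < y i by rewrite ltr_wpDl ?cF// mulr_ge0// ltW.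
have xy i : x i <= y i.
  rewrite /y -[leLHS]addr0 lerD ?(ltW (cF i))// ler_peMl// powRN.
  rewrite invf_ge1 ?powR_gt0//; have /andP[t0 t1] := t01 i => //.
  apply: (@le_trans _ _ (1 `^ alpha)); last by rewrite powR1.
  by apply: ge0_ler_powR; rewrite ?nnegrE ?(ltW alpha_gt0) ?(ltW t0) ?(ltW t1).
have M1 : 0 < M + 1 by rewrite ltr_wpDl.
have sum_c : \sum_i y i / (M + 1) <= 1.
  rewrite -mulr_suml ler_pdivrMr// mul1r big_split/= lerD//.
  rewrite sumr_const -[X in X *+ _]mulr1 -mulrnAr.
  have [->|nz] := eqVneq #|{: F}| 0%N; first by rewrite mulr0n mulr0.
  by rewrite mulVf// pnatr_eq0.
have fE w : f w = g w + \sum_(i : F) a (val i) w.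
  have -> : g w = f w - \sum_(i : F) a (val i) w.
    by rewrite -[LHS]/(f w - partial_sum a F w) /partial_sum fct_sumE.
  by rewrite subrK.
have key n : (\int[mu]_w K_excess k ((M + 1) * level n) (f' w) <=
    (dl * (1 + m) + \sum_i level n `^ (1 - p_exp (theta i)) * x i)%:E)%E.
  have l0 : 0 < (M + 1) * level n by rewrite mulr_gt0// level_gt0.
  have c0 i : 0 < y i / (M + 1) by rewrite divr_gt0.
  apply: le_trans (integral_K_excess_le k_dens j_le l0 t01 c0 sum_c sf' ff' sg
    fE xE) _.
  rewrite EFinD; apply: leeD; first by rewrite EFinM EFinD -mE.
  rewrite lee_fin; apply: ler_sum => i _.
  (* The share c_i (M + 1) level(n) is y_i level(n), and y_i^(1 - p) x_i^p <= x_i because x_i <=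
     y_i. *)
  rewrite mulrA divfK ?gt_eqF// powRM ?(ltW (y0 i)) ?(ltW (level_gt0 n))//.
  rewrite mulrAC mulrC ler_wpM2l ?powR_ge0//.
  by apply: powR_shift_le => //; exact: p_exp_gt1.
apply: (@le_trans _ _ (\sum_(0 <= n < N) (q ^+ n *
   (dl * (1 + m) + \sum_i level n `^ (1 - p_exp (theta i)) * x i))%:E)%E).
  apply: lee_sum => n _; rewrite EFinM lee_wpmul2l// lee_fin exprn_ge0//.
rewrite sumEFin lee_fin; under eq_bigr do rewrite mulrDr.
rewrite big_split/= -mulr_suml; apply: lerD.
  have -> : dl * (1 + m) = (S + 1)^-1 by rewrite /dl; field; rewrite !gt_eqF.
  by rewrite -/S ler_pdivrMr// mul1r lerDl.
under eq_bigr do rewrite mulr_sumr.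
rewrite exchange_big/=; apply: (@le_trans _ _ (\sum_i C * (theta i `^ (- alpha)
  * x i))).
  apply: ler_sum => i _; under eq_bigr do rewrite mulrA.
  by rewrite -mulr_suml mulrA ler_wpM2r// hC.
by rewrite -mulr_sumr ler_wpM2l.
Qed.

End family_sums.

(** * Decomposition of a function *)

Section selection.
Context {R : realType} d (T : measurableType d).
Context {A0 A1 : completeNormedModType R}.
Variable j : {linear A1 -> A0}.

(* Nearly optimal elements of [A1] are chosen for the countably many values of
   simple functions approximating [f], not for the values of [f] itself: this is
   what makes the selection measurable. *)
Lemma measurable_selection (f : T -> A0) (L e : R) :
  simple_limit f -> 0 <= L -> 0 < e ->
  exists b : T -> A1, [/\ eventually_simple b, forall w, `|b w| <= L &
    forall w, `|f w - j (b w)| <= E_functional j L (f w) + e].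
Proof.
move=> sf L0 e0; have [s ss cs] := sf.
have e30 : 0 < e / 3 by rewrite divr_gt0.
have hb x : exists a, `|a| <= L /\ `|x - j a| < E_functional j L x + e / 3.
  exact: E_functional_lt.
have [beta hbeta] := choice hb.
pose P m := [set w | `|f w - s m w| <= e / 3].
have mP m : measurable (P m).
  have sl : simple_limit (s m) by exact: simple_limit_simple.
  rewrite -[X in measurable X]setTI (_ : P m = (fun w =>
    `|f w - s m w|) @^-1` `]-oo, e / 3]).
    exact: (simple_limit_norm (simple_limitB sf sl)).
  by apply/seteqP; split => w /=; rewrite in_itv.
(* [g m w] is the first value s(i, w) with i < m that is within e / 3 of f(w), and [None] as long as
   there is none; once found it never changes. *)
pose fix g (m : nat) (w : T) {struct m} : option A0 := if m is m'.+1 then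
  (if g m' w is Some x then Some x else if `[< P m' w >] then Some (s m' w)
    else None)
  else None.
have sg m : simple_map (g m).
  elim: m => [|m IH]; first exact: simple_map_cst.
  exact: (simple_map_comp2 (fun (o : option A0) (p : option A0) =>
    if o is Some x then Some x else p)
   IH (simple_map_comp2 (fun (b : bool) x =>
     if b then Some x else None) (simple_map_bool (mP m)) (ss m))).
have gP m w x : g m w = Some x -> `|f w - x| <= e / 3.
  elim: m => //= m IH; case E: (g m w) => [y|]; first by move=> [yx];
    apply: IH; rewrite E yx.
  by case: asboolP => // Pm [<-].
have gS m n w x : g m w = Some x -> g (n + m)%N w = Some x.
  by move=> gm; elim: n => //= n ->.
have ex w : exists x, (\forall m \near \oo, g m w = Some x) /\ `|f w - x|
  <= e / 3.
  have [m Pm] : exists m, P m w.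
    have := cs w => /cvgrPdist_le/(_ _ e30)[m _ h].
    by exists m; apply: h => /=.
  have [x gx] : exists x, g m.+1 w = Some x.
    by rewrite /=; case: (g m w) => [x|]; [exists x|exists (s m w);
      rewrite asboolT].
  exists x; split; last exact: gP gx.
  by exists m.+1 => // n /= mn; rewrite -(subnK mn); exact: gS.
have [c hc] := choice ex.
exists (beta \o c); split.
- apply: eventually_simple_comp; exists (fun m => odflt 0 \o g m).
    by move=> m; exact: simple_map_comp.
  by move=> w; have [h _] := hc w; apply: filterS h => m /= ->.
- by move=> w; have [] := hbeta (c w).
- move=> w /=; have [_ h1] := hc w; have [_ h2] := hbeta (c w).
  (* One third of [e] for the distance from f(w) to c(w), one for the choice of [beta], one for the
     E-functional at c(w) instead of f(w). *)
  have h3 := E_functional_lip j (c w) (f w) L0; rewrite distrC in h3.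
  have : `|f w - j (beta (c w))| <= `|f w - c w| + `|c w - j (beta (c w))|.
    by rewrite (le_trans _ (ler_normD _ _))// addrA subrK.
  lra.
Qed.

End selection.

(** * Sums over (0, 1) supported on a sequence *)

Section reindexing.
Context {R : realType}.
Implicit Types n N : nat.

Definition theta_idx n : unit_open R := exist _ (theta_ n) (theta_01 n).

Lemma theta_idx_inj : injective theta_idx.
Proof.
move=> m n /(congr1 val)/= /invr_inj/eqP.
rewrite -!natrX eqr_nat => /eqP h; apply/eqP; rewrite -eqSS -(@eqn_exp2l 2)//.
exact/eqP.
Qed.

Lemma theta_idx_bound (s : seq (unit_open R)) :
  exists N, forall n, theta_idx n \in s -> (n < N)%N.
Proof.
elim: s => [|x s [N hN]]; first by exists 0%N.
have [[m xm]|nx] := pselect (exists m, x = theta_idx m).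
  exists (maxn N m.+1) => n; rewrite inE xm => /orP[/eqP/theta_idx_inj->|/hN h].
    by rewrite leq_max ltnSn orbT.
  by rewrite leq_max h.
exists N => n; rewrite inE => /orP[/eqP h|/hN//].
by case: nx; exists n.
Qed.

(** Each term is written as a sum over n with at most one nonzero entry, and the two sums are
    exchanged. *)
Lemma sum_theta_idx (V : nmodType) (G : unit_open R -> V) (s : seq (unit_open
  R)) N :
  uniq s -> (forall n, theta_idx n \in s -> (n < N)%N) ->
  (forall x, (forall n, x <> theta_idx n) -> G x = 0) ->
  \sum_(i <- s) G i =
  \sum_(0 <= n < N) (if theta_idx n \in s then G (theta_idx n) else 0).
Proof.
move=> us hN G0.
transitivity (\sum_(i <- s) \sum_(0
  <= n < N) (if i == theta_idx n then G i else 0)).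
  rewrite big_seq [RHS]big_seq; apply: eq_bigr => i si.
  have [[m im]|ni] := pselect (exists m, i = theta_idx m).
    have mN : (m < N)%N by apply: hN; rewrite -im.
    rewrite (bigD1_seq m) ?iota_uniq ?mem_index_iota//=.
    rewrite im eqxx big1 ?addr0// => n nm.
    by case: eqP => // /theta_idx_inj mn; rewrite mn eqxx in nm.
  rewrite G0; last by move=> n h; apply: ni; exists n.
  by rewrite big1// => n _; case: ifP.
rewrite exchange_big/=; apply: eq_bigr => n _; case: ifPn => ns.
  rewrite (bigD1_seq (theta_idx n))//= eqxx big1 ?addr0// => i /negbTE ->//.
rewrite big_seq big1// => i si; case: eqP => // h.
by rewrite -h si in ns.
Qed.

Lemma bounded_sum_tail (t : nat -> R) (B e : R) : (forall n, 0 <= t n) ->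
  (forall N, \sum_(0 <= n < N) t n <= B) -> 0 < e ->
  exists N, forall N', (N <= N')%N -> \sum_(N <= n < N') t n <= e.
Proof.
move=> t0 tB e0.
have hs : has_sup (range (fun N => \sum_(0 <= n < N) t n)).
  split; first by exists (\sum_(0 <= n < 0) t n), 0%N.
  by exists B => _ [N _ <-].
have [_ [N _ <-] hN] := sup_adherent e0 hs.
exists N => N' NN'.
have : \sum_(0 <= n < N') t n <= sup (range (fun N => \sum_(0 <= n < N) t n)).
  by apply: ub_le_sup; [exact: hs.2|exists N'].
by rewrite (big_cat_nat (n := N))//=; lra.
Qed.

End reindexing.

(** * The telescoping decomposition and its norm *)

Section sufficiency.
Context {R : realType} d (T : measurableType d).
Variable mu : {finite_measure set T -> \bar R}.
Context {A0 A1 : completeNormedModType R}.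
Notation leb := (@lebesgue_measure R).
Variable j : {linear A1 -> A0}.
Variable k : R -> A0 -> R.
Hypothesis k_dens : is_K_density j k.
Hypothesis j_le : forall a, `|j a| <= `|a|.
Variable alpha : R.
Hypothesis alpha_gt0 : 0 < alpha.
Variable f : T -> A0.
Hypothesis sf : simple_limit f.
Hypothesis intf : (\int[mu]_w `|f w|%:E < +oo)%E.

Let q : R := 2 `^ alpha.
(** Both the error of the selection and the additive term of [level_powR_theta]. *)
Let y n : R := ((2 * q) ^+ n)^-1.

Let q1 : 1 < q. Proof. exact: q_gt1. Qed.
Let q0 : 0 < q. Proof. exact: lt_trans q1. Qed.
Let y0 n : 0 < y n.
Proof. by rewrite invr_gt0 exprn_gt0// mulr_gt0. Qed.

Variable b : nat -> T -> A1.
Hypothesis b_simple : forall n, eventually_simple (b n).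
Hypothesis b_le : forall n w, `|b n w| <= 2 * level n.
Hypothesis b_approx : forall n w,
  (`|f w - j (b n w)|%:E <= 2%:E * K_excess k (level n) (f w) + (y n)%:E)%E.

Variable B : R.
Hypothesis B_le : forall N, (\sum_(0 <= n < N) (q ^+ n)%:E *
  \int[mu]_w K_excess k (level n) (f w) <= B%:E)%E.

Let m := fine (mu setT).
Let m0 : 0 <= m. Proof. by rewrite fine_ge0. Qed.
Let mE : mu setT = m%:E. Proof. by rewrite fineK// fin_num_measure. Qed.

Let I n := fine (\int[mu]_w K_excess k (level n) (f w))%E.
Let I_ge0 n : (0 <= \int[mu]_w K_excess k (level n) (f w))%E.
Proof. by apply: integral_ge0 => w _; exact: excess_ge0. Qed.
Let IE n : (\int[mu]_w K_excess k (level n) (f w) = (I n)%:E)%E.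
Proof.
rewrite /I fineK// ge0_fin_numE//; apply: le_lt_trans intf.
apply: ge0_le_integralT => w; first exact: excess_ge0.
by apply: (K_excess_le_norm k_dens); rewrite ltW// level_gt0.
Qed.
Let sumI N : \sum_(0 <= n < N) q ^+ n * I n <= B.
Proof.
rewrite -lee_fin -sumEFin; apply: le_trans (B_le N); apply: lee_sum => n _.
by rewrite IE EFinM.
Qed.

Let jb_limit n : simple_limit (fun w => f w - j (b n w)).
Proof.
apply: simple_limitB => //; apply: eventually_simple_limit.
exact: (eventually_simple_comp j (b_simple n)).
Qed.

Let norm_meas (g : T -> A0) : simple_limit g -> measurable_fun setT (fun w =>
  `|g w|%:E).
Proof. by move=> sg; apply/measurable_EFinP; exact: simple_limit_norm. Qed.

Let E n := fine (\int[mu]_w `|f w - j (b n w)|%:E)%E.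

Let K_excess_measurable l : measurable_fun setT (fun w => K_excess k l (f w)).
Proof.
apply: (density_section_measurable k_dens j_le sf (phi := fun y =>
  Num.max (y - l) 0)).
  by move=> z _; rewrite le_max lexx orbT.
by apply: measurable_maxr => //; apply: measurable_funB.
Qed.

Let int_fb n : (\int[mu]_w `|f w - j (b n w)|%:E <= (2 * I n + y n * m)%:E)%E.
Proof.
apply: (@le_trans _ _ (\int[mu]_w (2%:E * K_excess k (level n) (f w)
  + cst (y n)%:E w))%E).
  by apply: ge0_le_integralT => // w; exact: b_approx.
have h1 w : setT w -> (0 <= 2%:E * K_excess k (level n) (f w))%E.
  by move=> _; rewrite mule_ge0// excess_ge0.
have h2 : measurable_fun setT (fun w => 2%:E * K_excess k (level n) (f w))%E.
  exact: measurable_funeM.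
have h3 (w : T) : setT w -> (0 <= cst (y n)%:E w)%E by rewrite lee_fin ltW.
rewrite (ge0_integralD mu measurableT h1 h2 h3 (measurable_cst _)).
rewrite integral_cst// ge0_integralZl_EFin//; last by move=> w _;
  exact: excess_ge0.
by rewrite IE [leRHS]EFinD !EFinM -mE; exact: lexx.
Qed.

Let EE n : (\int[mu]_w `|f w - j (b n w)|%:E = (E n)%:E)%E.
Proof.
rewrite /E fineK// ge0_fin_numE; last exact: integral_ge0.
exact: le_lt_trans (int_fb n) (ltry _).
Qed.
Let E0 n : 0 <= E n. Proof. by rewrite fine_ge0// integral_ge0. Qed.
Let E_le n : E n <= 2 * I n + y n * m.
Proof. by rewrite -lee_fin -EE. Qed.

Definition increment n w := if n is n'.+1 then b n w - b n' w else b 0%N w.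

Let inc_simple n : eventually_simple (increment n).
Proof.
case: n => [|n]; first exact: b_simple.
exact: (eventually_simple_comp (fun p => p.1 - p.2)
  (eventually_simple_pair (b_simple n.+1) (b_simple n))).
Qed.

Let level_le n : level n <= level n.+1 :> R.
Proof.
by apply: le_trans (level_ge2 _); rewrite ler_peMl ?ltW ?level_gt0// ltr1n.
Qed.

Let inc_le n w : `|increment n w| <= 4 * level n.
Proof.
case: n => [|n] /=.
  by apply: le_trans (b_le 0 w) _; rewrite ler_wpM2r ?ler_nat// ltW// level_gt0.
apply: le_trans (ler_normB _ _) _.
have := b_le n.+1 w; have := b_le n w; have := level_le n; lra.
Qed.

Let sum_inc N w : \sum_(0 <= n < N.+1) increment n w = b N w.
Proof.
elim: N => [|N IH]; first by rewrite big_nat1.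
by rewrite big_nat_recr//= IH addrC subrK.
Qed.

Let inc_limit n : simple_limit (fun w => j (increment n w)).
Proof.
apply: eventually_simple_limit;
  exact: (eventually_simple_comp j (inc_simple n)).
Qed.

Let X n := fine (\int[mu]_w `|j (increment n w)|%:E)%E.

Let int_inc0 : (\int[mu]_w `|j (increment 0 w)|%:E <= (2 * level 0 * m)%:E)%E.
Proof.
rewrite EFinM -mE -integral_cst//; apply: ge0_le_integralT => // w.
by rewrite lee_fin (le_trans (j_le _))// b_le.
Qed.

Let int_incS n : (\int[mu]_w `|j (increment n.+1 w)|%:E <= (E n.+1 + E n)%:E)%E.
Proof.
rewrite EFinD -!EE -ge0_integralD//; try exact: norm_meas.
apply: ge0_le_integralT => // w; rewrite -EFinD lee_fin /= linearB.
have -> : j (b n.+1 w) - j (b n w) = (f w - j (b n w)) - (f w - j (b n.+1 w)).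
  by rewrite opprB [RHS]addrC addrA subrK.
by apply: le_trans (ler_normB _ _) _; rewrite [leLHS]addrC.
Qed.

Let XE n : (\int[mu]_w `|j (increment n w)|%:E = (X n)%:E)%E.
Proof.
rewrite /X fineK// ge0_fin_numE; last exact: integral_ge0.
case: n => [|n]; first exact: le_lt_trans int_inc0 (ltry _).
exact: le_lt_trans (int_incS n) (ltry _).
Qed.
Let X_ge0 n : 0 <= X n. Proof. by rewrite fine_ge0// integral_ge0. Qed.

Let c1 : R := 4 * expR 1 * (2 * q).
Let c1_ge0 : 0 <= c1. Proof. by rewrite !mulr_ge0// ?expR_ge0// ltW. Qed.

(** Apply [interp_norm_upper] pointwise with A the A0-norm and B = 4 level(n), then integrate. As (p
    - 1) / p = theta and 1 / p = 1 - theta, the norm is at most B^theta X^(1 - theta). *)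
Lemma bochner_increment n :
  (scaled_norm (theta_ n `^ (- alpha))
    (bochner_norm mu (interp_norm j (theta_ n) (p_exp (theta_ n))) (p_exp
      (theta_ n))%:E)
    (fun w => j (increment n w)) <= (q ^+ n.+1 * (c1 * (X n + y n)))%:E)%E.
Proof.
rewrite /scaled_norm theta_powRN EFinM lee_wpmul2l ?lee_fin ?exprn_ge0 ?(ltW
  q0)//.
have t01 : 0 < (theta_ n : R) < 1 by exact: theta_01.
set t := theta_ n in t01 *.
have p1 := p_exp_gt1 t01; set p := p_exp t in p1 *.
have p0 : 0 < p by rewrite (lt_trans _ p1).
have l0 : 0 < 4 * level n :> R by rewrite mulr_gt0// level_gt0.
have i0 : interp_norm j t p 0%R = 0%E by exact: interp_norm0.
(* Approximation in A0 would not give strong measurability for the stronger interpolation norm;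
   eventual equality with simple maps does. *)
rewrite /bochner_norm asboolT; last first.
  apply: strongly_measurable_eventually_simple => //.
    by move=> w; exact: interp_norm_image.
  exact: (eventually_simple_comp j (inc_simple n)).
apply: (@le_trans _ _ ((4 * level n) `^ t * X n `^ (1 - t))%:E); last first.
  by rewrite lee_fin /c1; exact: level_powR_theta.
have h : ('N[mu]_p%:E[interp_norm j t p \o (fun w => j (increment n w))] `^ p
    <= ((4 * level n) `^ (p - 1) * X n)%:E)%E.
  rewrite poweR_Lnorm ?gt_eqF// EFinM -XE -ge0_integralZl_EFin ?powR_ge0//;
    last exact: norm_meas.
  apply: ge0_le_integralT => w; first exact: poweR_ge0.
  rewrite gee0_abs ?interp_norm_ge0//= -EFinM mulrC.
  apply: interp_norm_upper => //.
  - by move=> s s0; rewrite K_le_norm// ltW.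
  - move=> s s0; apply: le_trans (K_image j _ (ltW s0)) _.
    by rewrite mulrC ler_pM2r.
have := @gt0_ler_poweR _ p^-1 _ _ _ _ _ h.
rewrite -poweRrM mulfV ?gt_eqF// poweRe1//.
rewrite poweR_EFin (powRM _ (powR_ge0 _ _) (X_ge0 n)) -powRrM.
have -> : (p - 1) / p = t by rewrite -(p_exp_mull t01) mulfK ?gt_eqF.
have -> : p^-1 = 1 - t by rewrite /p /p_exp invrK.
apply; last 2 first.
- by rewrite in_itv/= leey andbT poweR_ge0.
- by rewrite in_itv/= leey andbT lee_fin mulr_ge0 ?powR_ge0.
by rewrite subr_ge0 ltW//; case/andP: t01.
exact: Lnorm_ge0.
Qed.

Let qy n : q ^+ n * y n = 2^-1 ^+ n.
Proof. 
by rewrite /y exprMn invfM mulrCA mulfV ?gt_eqF ?exprn_gt0// mulr1 exprVn.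
Qed.

Let sum_half N : \sum_(0 <= n < N) 2^-1 ^+ n <= 2 :> R.
Proof.
suff -> : \sum_(0 <= n < N) 2^-1 ^+ n = 2 - 2 * 2^-1 ^+ N :> R.
  by rewrite gerBl mulr_ge0// exprn_ge0// invr_ge0.
elim: N => [|N IH]; first by rewrite big_geq// expr0; lra.
by rewrite big_nat_recr//= IH exprS; lra.
Qed.

Let sumE N : \sum_(0 <= n < N) q ^+ n * E n <= 2 * B + 2 * m.
Proof.
apply: (@le_trans _ _ (\sum_(0 <= n < N) (2 * (q ^+ n * I n) + 2^-1 ^+ n * m))).
  apply: ler_sum => n _; rewrite -qy.
  have := ler_wpM2l (exprn_ge0 n (ltW q0)) (E_le n); lra.
rewrite big_split/= -mulr_sumr -mulr_suml lerD//.
  by rewrite ler_wpM2l.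
by rewrite ler_wpM2r.
Qed.

(** One summable sequence dominating the weighted norm of the n-th term, its L1 norm and the n-th
    approximation error, hence controlling both the norm and the convergence. *)
Let total n := q ^+ n.+1 * (c1 * (X n + y n)) + E n.

Let total_ge0 n : 0 <= total n.
Proof.
by rewrite addr_ge0// mulr_ge0 ?exprn_ge0 ?(ltW q0)// mulr_ge0// addr_ge0// ltW.
Qed.

(** Passing through f, an increment costs two consecutive errors; the index shift of the earlier one
    costs a factor q. The first increment is bounded by the size of [b 0]. *)
Let sumX N : \sum_(0 <= n < N) q ^+ n * X n
  <= 2 * level 0 * m + (1 + q) * (2 * B + 2 * m).
Proof.
have X0 : X 0 <= 2 * level 0 * m by rewrite -lee_fin -XE.
have XS n : X n.+1 <= E n.+1 + E n by rewrite -lee_fin -XE.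
have s0 M : 0 <= \sum_(0 <= n < M) q ^+ n * E n.
  by apply: sumr_ge0 => n _; rewrite mulr_ge0// exprn_ge0// ltW.
case: N => [|N].
  rewrite big_geq//; have := s0 0%N; have := sumE 0; have := q0;
    have := X_ge0 0; nra.
rewrite big_nat_recl//= expr0 mul1r lerD//.
apply: (@le_trans _ _ (\sum_(0 <= n < N) q ^+ n.+1 * E n.+1 + q * \sum_(0
  <= n < N) q ^+ n * E n)).
  rewrite mulr_sumr -big_split/=; apply: ler_sum => n _.
  by rewrite mulrA -exprS -mulrDr ler_wpM2l// exprn_ge0// ltW.
rewrite mulrDl mul1r lerD//; last by rewrite ler_wpM2l// ltW.
apply: le_trans (sumE N.+1); rewrite big_nat_recl//= lerDr.
by rewrite mulr_ge0 ?exprn_ge0// ltW.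
Qed.

Let sum_total : exists C, forall N, \sum_(0 <= n < N) total n <= C.
Proof.
exists (q * c1 * (2 * level 0 * m + (1 + q) * (2 * B + 2 * m) + 2) + (2 * B
  + 2 * m)) => N.
rewrite /total big_split/= lerD//; last first.
  apply: le_trans (sumE N); apply: ler_sum => n _.
  by rewrite ler_peMl// exprn_ege1// ltW.
apply: (@le_trans _ _ (q * c1 * (\sum_(0 <= n < N) q ^+ n * X n + \sum_(0
  <= n < N) 2^-1 ^+ n))).
  rewrite -big_split/= mulr_sumr; apply: ler_sum => n _; rewrite -qy exprS.
  by rewrite le_eqVlt; apply/orP; left; apply/eqP; ring.
by rewrite ler_wpM2l ?mulr_ge0 ?(ltW q0)// lerD.
Qed.

Let X_total n : X n <= total n.
Proof.
rewrite /total -[leLHS]addr0 lerD//.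
have q_ge1 : 1 <= q ^+ n.+1 by rewrite exprn_ege1// ltW.
have c1_ge1 : 1 <= c1.
  rewrite /c1; have := expR_ge1Dx (1 : R); have := q1; nra.
apply: (@le_trans _ _ (X n + y n)); first by rewrite lerDl ltW.
have z0 : 0 <= X n + y n by rewrite addr_ge0// ltW.
apply: (@le_trans _ _ (c1 * (X n + y n))); first by rewrite ler_peMl.
by rewrite ler_peMl// mulr_ge0.
Qed.

Let E_total n : E n <= total n.
Proof.
rewrite /total lerDr; apply: mulr_ge0; first by rewrite exprn_ge0 ?(ltW q0).
by rewrite mulr_ge0// addr_ge0// ltW.
Qed.

(** The family must be indexed by all of (0, 1), hence the value 0 off the sequence; injectivity of
    [theta_idx] makes the chosen index the right one. *)
Definition increment_family (i : unit_open R) : T -> A0 :=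
  if pselect (exists n, i = theta_idx n) is left h
  then fun w => j (increment (sval (cid h)) w) else fun=> 0.

Lemma increment_familyE n : increment_family (theta_idx n) = fun w =>
  j (increment n w).
Proof.
rewrite /increment_family; case: pselect => [h|]; last by case; exists n.
by case: cid => i /= /theta_idx_inj <-.
Qed.

Lemma increment_family0 i : (forall n,
  i <> theta_idx n) -> increment_family i = fun=> 0.
Proof. by move=> h; rewrite /increment_family; case: pselect => [ex|//];
  have [n /h] := ex. Qed.

Variable f0 : T -> A0.
Hypothesis ff0 : {ae mu, forall w, f0 w = f w}.

(** Once a finite set contains the first N + 1 indices, the remainder is f - j(b_N) minus some later
    increments, so its L1 norm is at most a tail of [total]. *)
Lemma increment_family_sum : is_family_sum (L1_Loo_norm mu j) increment_family
  f0.
Proof.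
have [C hC] := sum_total.
move=> U [e /= e0 hU].
have e20 : 0 < e / 2 by rewrite divr_gt0.
have [N hN] := bounded_sum_tail total_ge0 hC e20.
(* The terms 0, ..., N telescope to [b N]. *)
exists [fset theta_idx n | n in iota 0 N.+1]%fset => // F /= NF.
set g := f0 - _.
suff hg : strongly_measurable mu norm0 g /\ (\int[mu]_w `|g w|%:E
  <= (e / 2)%:E)%E.
  have [sg ig] := hg.
  have h1 := le_trans (L1_Loo_norm_le j_le sg) ig.
  have h0 : (0 <= L1_Loo_norm mu j g)%E.
    apply: le_ereal_inf_tmp => _ [z _ <-].
    by rewrite adde_ge0// bochner_norm_ge0.
  have fin : L1_Loo_norm mu j g \is a fin_num.
    by rewrite ge0_fin_numE// (le_lt_trans h1)// ltry.
  rewrite -[X in U X]fineK//; apply: hU => /=.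
  rewrite sub0r normrN ger0_norm ?fine_ge0//.
  have : (fine (L1_Loo_norm mu j g))%:E%E = L1_Loo_norm mu j g by rewrite fineK.
  move=> h2; rewrite -h2 lee_fin in h1; lra.
have [N1 hN1] := theta_idx_bound (enum_fset F).
pose N' := maxn N1 N.+1.
have NN' : (N.+1 <= N')%N by rewrite leq_maxr.
have hN' n : theta_idx n \in enum_fset F -> (n < N')%N.
  by move=> /hN1 h; rewrite leq_max h.
have inF n : (n <= N)%N -> theta_idx n \in enum_fset F.
  move=> nN; apply: (fsubsetP NF); apply/imfsetP; exists n => //=.
  by rewrite -[_ :: _]/(iota 0 N.+1) mem_iota.
pose r n w := if theta_idx n \in enum_fset F then j (increment n w) else 0.
have gE w : f0 w = f w -> g w = (f w - j (b N w)) - \sum_(N.+1 <= n < N') r n w.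
  move=> <-; rewrite -[LHS]/(f0 w - partial_sum increment_family F w)
    /partial_sum fct_sumE.
  rewrite -(big_seq_fsetE _ F xpredT (fun i => increment_family i w))/=.
  rewrite (sum_theta_idx (fset_uniq F) hN'); last first.
    by move=> i hi; rewrite increment_family0.
  rewrite (big_cat_nat (n := N.+1))//= opprD addrA; congr (_ - _ - _).
    rewrite -sum_inc linear_sum; apply: eq_big_nat => n /andP[_ nN].
    by rewrite inF// increment_familyE.
  by apply: eq_bigr => n _; rewrite /r increment_familyE.
have sr : simple_limit (fun w => \sum_(N.+1 <= n < N') r n w).
  apply: simple_limit_sum => n; rewrite /r;
    case: (theta_idx n \in enum_fset F); first exact: inc_limit.
  by apply: simple_limit_simple; exact: simple_map_cst.
split.
  apply: (strongly_measurable_simple_limit (simple_limitB (jb_limit N) sr)).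
  by apply: filterS ff0 => w /gE.
apply: (@le_trans _ _ (\int[mu]_w (`|f w - j (b N w)|%:E + \sum_(N.+1
  <= n < N') `|j (increment n w)|%:E))%E).
  apply: ae_ge0_le_integralT => //.
    by move=> w; rewrite adde_ge0// sume_ge0.
  apply: filterS ff0 => w /gE ->; rewrite sumEFin -EFinD lee_fin.
  apply: le_trans (ler_normB _ _) _; rewrite lerD2l.
  apply: le_trans (ler_norm_sum _ _ _) _; apply: ler_sum => n _.
  by rewrite /r; case: ifP => // _; rewrite normr0.
rewrite ge0_integralD//; last 3 first.
- exact: norm_meas.
- by move=> w _; rewrite sume_ge0.
- by apply: emeasurable_sum => n; exact: norm_meas.
rewrite ge0_integral_sum//; last by move=> n; exact: norm_meas.
rewrite EE; under eq_bigr do rewrite XE.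
rewrite sumEFin -EFinD lee_fin; apply: le_trans (hN N' (ltnW NN')).
rewrite [leRHS]big_ltn// lerD ?E_total//; apply: ler_sum => n _; exact: X_total.
Qed.

Lemma family_sum_norm_lty : (L1_Loo_norm mu j f0 < +oo)%E ->
  (family_sum_norm (L1_Loo_norm mu j)
      (fun theta : unit_open R =>
        scaled_norm (val theta `^ (- alpha))
          (bochner_norm mu (interp_norm j (val theta) (p_exp (val theta)))
            (p_exp (val theta))%:E)) f0 < +oo)%E.
Proof.
move=> nf; have [C hC] := sum_total.
apply: le_lt_trans (ltry C).
apply: ereal_inf_le; eexists; first by exists increment_family => //;
  split => //; exact: increment_family_sum.
apply: ge_ereal_sup => _ [A [fA _] <-].
rewrite fsbig_finite//=.
have [N hN] := theta_idx_bound (enum_fset (fset_set A)).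
rewrite (sum_theta_idx (fset_uniq _) hN); last first.
  move=> i hi; rewrite increment_family0// /scaled_norm bochner_norm0 ?mule0//.
    by apply: interp_norm0; exact: valP i.
  have i01 : 0 < val i < 1 by exact: valP i.
  by rewrite eqe gt_eqF// (lt_trans _ (p_exp_gt1 i01)).
apply: (@le_trans _ _ (\sum_(0 <= n < N) (total n)%:E)%E).
  apply: lee_sum => n _; case: ifP => _; last by rewrite lee_fin.
  rewrite increment_familyE; apply: le_trans (bochner_increment n) _.
  by rewrite lee_fin lerDl.
by rewrite sumEFin lee_fin.
Qed.

End sufficiency.

Theorem theorem13 (R : realType) (d : measure_display) (Omega : measurableType d)
    (mu : {finite_measure set Omega -> \bar R})
    (A0 A1 : completeNormedModType R) (j : {linear A1 -> A0})
    (j_ordered : ordered_pair j) (j_dense : dense (range j))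
    (k : R -> A0 -> R) (k_density : is_K_density j k)
    (alpha : R) (alpha_gt0 : 0 < alpha) :
  [set f : Omega -> A0 |
    (family_sum_norm (L1_Loo_norm mu j)
      (fun theta : unit_open R =>
        scaled_norm (val theta `^ (- alpha))
          (bochner_norm mu (interp_norm j (val theta) (p_exp (val theta)))
            (p_exp (val theta))%:E)) f < +oo)%E] =
  [set f : Omega -> A0 |
    (L1_Loo_norm mu j f < +oo)%E /\
    zygmund (mu \x @lebesgue_measure R)%E ([set: Omega] `*` `]0, 1[) alpha
      (fun z => k z.2 (f z.1))].
Proof.
have j_le := j_ordered.2.
have rep f : (L1_Loo_norm mu j f < +oo)%E -> exists f' : Omega -> A0,
    [/\ simple_limit f', {ae mu, forall w, f w = f' w} &
      (\int[mu]_w `|f' w|%:E < +oo)%E].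
  move=> nf; have NB0 : (0 <= L1_Loo_norm mu j f)%E.
    apply: le_ereal_inf_tmp => _ [z _ <-].
    by rewrite adde_ge0// bochner_norm_ge0.
  (* The added 1 provides the strict inequality in [L1_Loo_norm_bound]. *)
  have [sf if_] : strongly_measurable mu norm0 f /\
      (\int[mu]_w `|f w|%:E <= (fine (L1_Loo_norm mu j f) + 1)%:E * (1
        + mu setT))%E.
    apply: (L1_Loo_norm_bound j_le).
    rewrite -[X in (X < _)%E]fineK ?ge0_fin_numE// lte_fin ltrDl//.
  have [f' sf' ff'] := strongly_measurable_rep (fun x => lexx _) sf.
  exists f'; split => //.
  rewrite (@ae_eq_integralT _ _ _ _ (fun w => `|f' w|%:E) (fun w =>
    `|f w|%:E))//.
    apply: le_lt_trans if_ _; rewrite lte_mul_pinfty// ?lee_fin ?addr_ge0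
      ?fine_ge0//.
    by rewrite lte_add_pinfty ?ltry// -ge0_fin_numE// fin_num_measure.
  by apply: filterS ff' => w ->.
apply/seteqP; split => f /=.
  move=> /ereal_inf_lt[_ [a [nf fam] <-] sum_a].
  split => //; have [f' [sf' ff' if']] := rep f nf.
  set W := (fun theta : unit_open R => _) in sum_a.
  have W0 i : (0 <= W i)%E.
    by rewrite mule_ge0 ?bochner_norm_ge0// lee_fin powR_ge0.
  have s0 : (0 <= \esum_(i in [set: unit_open R]) W i)%E.
    by apply: esum_ge0 => i _.
  pose M := fine (\esum_(i in [set: unit_open R]) W i).
  have M0 : 0 <= M by rewrite fine_ge0.
  have ME : (\esum_(i in [set: unit_open R]) W i = M%:E)%E.
    by rewrite fineK// ge0_fin_numE.
  have hM (F : {fset unit_open R}) :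
      (\sum_(i : F) scaled_norm (val (val i) `^ (- alpha))
        (bochner_norm mu (interp_norm j (val (val i)) (p_exp (val (val i))))
          (p_exp (val (val i)))%:E) (a (val i)) <= M%:E)%E.
    rewrite -ME; apply: esum_ge; exists [set` F].
      by split => //; exact: finite_fset.
    by rewrite fsbig_finite ?finite_fset// set_fsetK big_seq_fsetE.
  have [B hB] := sum_K_excess_bounded k_density j_le alpha_gt0 M0 fam hM sf'
    ff'.
  apply: (zygmund_excess_bounded k_density j_le alpha_gt0 sf' ff' _ if' hB).
  by rewrite lerDr.
move=> [nf zf]; have [f' [sf' ff' if']] := rep f nf.
have [B hB] := excess_bounded_zygmund k_density j_le alpha_gt0 sf' ff' zf.
have q0 : 0 < 2 * 2 `^ alpha :> R by rewrite mulr_gt0// powR_gt0.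
(* The radius 2 level(n) is the one for which [E_functional_le_excess] bounds the error. *)
have sel n : exists b : Omega -> A1, [/\ eventually_simple b,
    forall w, `|b w| <= 2 * level n &
    forall w, `|f' w - j (b w)| <=
      E_functional j (2 * level n) (f' w) + ((2 * 2 `^ alpha) ^+ n)^-1].
  have L0 : 0 <= 2 * level n :> R by rewrite mulr_ge0// ltW// level_gt0.
  have e0 : 0 < ((2 * 2 `^ alpha) ^+ n)^-1 :> R by rewrite invr_gt0 exprn_gt0.
  exact: measurable_selection.
have [b hb] := choice sel.
have b1 n : eventually_simple (b n) by have [] := hb n.
have b2 n w : `|b n w| <= 2 * level n by have [] := hb n.
apply: (family_sum_norm_lty k_density j_le alpha_gt0 sf' if' b1 b2 _ hB ff' nf).
move=> n w; have [_ _ /(_ w) h] := hb n.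
apply: (@le_trans _ _ ((E_functional j (2 * level n) (f' w))%:E
  + (((2 * 2 `^ alpha) ^+ n)^-1)%:E)%E).
  by rewrite -EFinD lee_fin.
by rewrite leeD2r//; apply: E_functional_le_excess => //; exact: level_gt0.
Qed.
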